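(* Let $\mathfrak P=(P_n)_{n\ge0}$ be a subfactor planar algebra and $k\ge 0$. Let $X,Y:\bigoplus_{n\ge 0}P_{n+k}\to\bigoplus_{n\ge 0}P_{n+k}$ be the linear maps defined in the context ($X$ the sum of all epi Temperley-Lieb diagrams, $Y$ the signed sum of all non-nested epi Temperley-Lieb diagrams). Then $XY=1=YX$.
   Context: $\mathfrak P=(P_n)_{n\ge 0}$ is a subfactor planar algebra; elements of $P_n$ label discs with $2n$ boundary points. Write $P_{n,k}=P_{n+k}$ for the $n$-th summand of $\bigoplus_{n\ge 0}P_{n+k}$ (algebraic direct sum); an element of $P_{n,k}$ is drawn as a box with $k$ strings on the left, $k$ on the right and $2n$ strings on top, with distinguished interval at the top left corner. A Temperley-Lieb (TL) diagram is a loopless planar pairing, up to isotopy, of boundary points on the bottom (incoming) and top (outgoing) sides of a rectangle. A TL diagram with $2i$ points on the bottom and $2j$ points on top is regarded as a linear map $P_{i,k}\to P_{j,k}$, by attaching its bottom points to the $2i$ top strings of an element of $P_{i,k}$. A TL diagram is epi if each point on its top side is connected to a point on its bottom side. A turn-back (cap) on the bottom is a strand with both endpoints on the bottom side. An epi TL diagram is non-nested if each turn-back on the bottom encloses no other turn-back. $X$ is the sum of all epi TL diagrams: its block $P_{i,k}\to P_{j,k}$ is the finite sum of all epi TL diagrams from $2i$ points to $2j$ points (the identity if $i=j$, zero if $i<j$). $Y$ is the signed sum of all non-nested epi TL diagrams: its block $P_{i,k}\to P_{j,k}$ is $(-1)^{i-j}$ times the sum of all non-nested epi TL diagrams from $2i$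 points to $2j$ points. *)

(* Defs.v *)
From HB Require Import structures.
From mathcomp Require Import all_boot all_order all_algebra.
From mathcomp Require Import boolp classical_sets fsbigop reals complex.

Set Implicit Arguments.
Unset Strict Implicit.
Unset Printing Implicit Defensive.

Import Order.TTheory GRing.Theory Num.Theory.
Local Open Scope ring_scope.

(******************************************************************************)
(* A disc of colour (n, s) has 2n boundary points, numbered 0, ..., 2n-1      *)
(* clockwise from its distinguished interval, which touches a region of shade *)
(* s (true = shaded).  Interval q of the disc is the one preceding point q    *)
(* clockwise, so interval 0 is the distinguished one; a disc without boundary *)
(* points has the single interval 0.                                          *)
(*                                                                            *)
(* Capping off the outer disc, a planar tangle is a decomposition of the      *)
(* oriented sphere into discs, strands (arcs and closed strands) and regions  *)
(* (spheres with holes), and it is determined up to isotopy by its incidence  *)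
(* data, the surface being recovered by gluing.  A tangle below is such       *)
(* incidence data, and the predicate planar says that the data are coherent   *)
(* and that the glued surface is a sphere.                                    *)
(******************************************************************************)

Definition color : Type := (nat * bool)%type.

Notation npoints c := ((c : color).1.*2).
Notation points c := 'I_(npoints c).
Notation intervals c := 'I_((npoints c).-1.+1).

(* inord sends an out of range value to 0, so that the interval after the
   last point is interval 0. *)
Definition before (c : color) (p : points c) : intervals c := inord p.
Definition after (c : color) (p : points c) : intervals c := inord p.+1.

(* None is the outer disc, Some d an input disc.  side x b is the region of
   shade b along the strand x. *)
Record tangle := Tangle {
  disc : finType;
  dcol : option disc -> color;
  strand : finType;
  region : finType;
  shade : region -> bool;
  side : strand -> bool -> region;
  pt : forall v : option disc, points (dcol v) -> strand;
  itv : forall v : option disc, intervals (dcol v) -> region }.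
Arguments dcol : clear implicits.
Arguments pt {t} v p.
Arguments itv {t} v q.
Arguments side {t} x b.

Section Planarity.
Variable T : tangle.

Definition point_shade (v : option (disc T)) (p : nat) : bool :=
  (dcol T v).2 (+) odd p.

Definition tpoint := {v : option (disc T) & points (dcol T v)}.
Definition strand_of (e : tpoint) : strand T := pt (tag e) (tagged e).

(* Whether, leaving the disc along the strand at e, one has the shaded region
   on the left.  Both input and outer discs are numbered clockwise, but their
   strands leave outwards and inwards respectively. *)
Definition outgoing (e : tpoint) : bool :=
  (tag e == None) (+) point_shade (tag e) (tagged e).

Definition mate (e : tpoint) : tpoint :=
  odflt e [pick e' : tpoint | (e' != e) && (strand_of e' == strand_of e)].

(* The next point clockwise around the disc, all discs being viewed as discs of
   the oriented sphere, which reverses the numbering of the outer one. *)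
Definition turn (e : tpoint) : tpoint :=
  match e with
  | existT (Some d) p =>
      Tagged (fun v => points (dcol T v)) (ordS p : points (dcol T (Some d)))
  | existT None p =>
      Tagged (fun v => points (dcol T v)) (ord_pred p : points (dcol T None))
  end.

Definition closed_strand (x : strand T) : bool :=
  [forall e : tpoint, strand_of e != x].

Definition narcs : nat := (\sum_(v : option (disc T)) (dcol T v).1)%N.

(* The boundary circles of the regions: the face cycles through the points,
   one circle around each disc without points, two for each closed strand. *)
Definition nboundaries : nat :=
  (fcard (turn \o mate) (predT : {pred tpoint})
   + #|[pred v : option (disc T) | (dcol T v).1 == 0%N]|
   + 2 * #|[pred x : strand T | closed_strand x]|)%N.

Definition adjacent : rel (region T) :=
  [rel r r' | [exists x : strand T, exists b : bool,
                 (r == side x b) && (r' == side x (~~ b))]].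

Record planar : Prop := Planar {
  planar_shade_itv : forall v (q : intervals (dcol T v)),
    shade (itv v q) = point_shade v q;
  planar_shade_side : forall (x : strand T) b, shade (side x b) = b;
  planar_before : forall v (p : points (dcol T v)),
    side (pt v p) (point_shade v p) = itv v (before p);
  planar_after : forall v (p : points (dcol T v)),
    side (pt v p) (~~ point_shade v p) = itv v (after p);
  (* two ends for an arc, none for a closed strand *)
  planar_ends : forall x : strand T, exists a : bool, forall b : bool,
    #|[pred e : tpoint | (strand_of e == x) && (outgoing e == b)]| = a;
  planar_connected : forall r r' : region T, connect adjacent r r';
  (* Euler characteristic 2: each disc contributes 1, each arc -1 and each
     region with h holes 2 - h *)
  planar_euler :
    (#|{: option (disc T)}| + 2 * #|region T| = 2 + narcs + nboundaries)%N }.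

End Planarity.

Section Gluing.
Variables (T S : tangle) (d : disc T).

Definition sum_dcol (w : option (disc T) + option (disc S)) : color :=
  match w with inl v => dcol T v | inr v => dcol S v end.
Definition sum_pt (w : option (disc T) + option (disc S)) :
    points (sum_dcol w) -> strand T + strand S :=
  match w with inl v => fun p => inl (pt v p) | inr v => fun p => inr (pt v p) end.
Definition sum_itv (w : option (disc T) + option (disc S)) :
    intervals (sum_dcol w) -> region T + region S :=
  match w with inl v => fun q => inl (itv v q) | inr v => fun q => inr (itv v q) end.
Definition sum_side (u : strand T + strand S) (b : bool) : region T + region S :=
  match u with inl x => inl (side x b) | inr x => inr (side x b) end.
Definition sum_shade (w : region T + region S) : bool :=
  match w with inl r => shade r | inr r => shade r end.

(* The boundary of the input disc d of T is identified with the boundary of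
   the outer disc of S. *)
Definition strand_glue : rel (strand T + strand S) := [rel u v |
  [exists p : points (dcol T (Some d)), exists q : points (dcol S None),
     [&& p == q :> nat, u == inl (pt (Some d) p) & v == inr (pt None q)]]].
Definition region_glue : rel (region T + region S) := [rel u v |
  [exists p : intervals (dcol T (Some d)), exists q : intervals (dcol S None),
     [&& p == q :> nat, u == inl (itv (Some d) p) & v == inr (itv None q)]]].

Definition symm (A : Type) (r : rel A) : rel A := [rel x y | r x y || r y x].

(* R is the result of gluing S into the disc d of T: its discs are the
   remaining ones, its strands and regions are the classes of strands and
   regions of T and S under the identification (a class of strands without
   remaining end points is a new closed strand).  As the maps e, f, g are
   arbitrary, any R isotopic to the composite qualifies; in particular gluing
   into an identity tangle yields the copies of S up to isotopy. *)
Record is_glued (R : tangle)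
    (e : option (disc R) -> option (disc T) + option (disc S))
    (f : strand T + strand S -> strand R)
    (g : region T + region S -> region R) : Prop := IsGlued {
  glued_color : dcol S None = dcol T (Some d);
  glued_outer : e None = inl None;
  glued_disc_inj : injective e;
  glued_disc_img : forall w,
    (exists v, e v = w) <-> (w <> inl (Some d) /\ w <> inr None);
  glued_dcol : forall v, dcol R v = sum_dcol (e v);
  glued_strand_surj : forall x, exists u, f u = x;
  glued_strand_ker : forall u u',
    f u = f u' <-> connect (symm strand_glue) u u';
  glued_region_surj : forall r, exists w, g w = r;
  glued_region_ker : forall w w',
    g w = g w' <-> connect (symm region_glue) w w';
  glued_pt : forall v (p : points (dcol R v)) (q : points (sum_dcol (e v))),
    p = q :> nat -> pt v p = f (sum_pt q);
  glued_itv : forall v (p : intervals (dcol R v))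
                     (q : intervals (sum_dcol (e v))),
    p = q :> nat -> itv v p = g (sum_itv q);
  glued_side : forall u b, side (f u) b = g (sum_side u b);
  glued_shade : forall w, shade (g w) = sum_shade w }.

End Gluing.

Definition eq_class (A : finType) (r : rel A) :=
  {B : {set A} | B \in [set [set y | connect r x y] | x : A]}.
Lemma eq_classP (A : finType) (r : rel A) (x : A) :
  [set y | connect r x y] \in [set [set y | connect r x' y] | x' : A].
Proof. exact: imset_f. Qed.
Definition to_class (A : finType) (r : rel A) (x : A) : eq_class r :=
  exist _ [set y | connect r x y] (eq_classP r x).

(* The tangle without closed strands whose arcs join the points e and m e, for
   a fixpoint-free involution m, and whose distinguished intervals all touch
   one and the same region. *)
Section ArcTangle.
Variables (D : finType) (col : option D -> color).
Local Notation tpoint := {v : option D & points (col v)}.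
Local Notation interval := {v : option D & intervals (col v)}.
Variable m : tpoint -> tpoint.

Definition arc_shade (i : interval) : bool :=
  (col (tag i)).2 (+) odd (tagged i).
Definition arc_touch (e : tpoint) (i : interval) : bool :=
  (i == Tagged (fun v => intervals (col v)) (before (tagged e)))
  || (i == Tagged (fun v => intervals (col v)) (after (tagged e))).
Definition arc_star (v : option D) : interval :=
  Tagged (fun v => intervals (col v)) (ord0 : intervals (col v)).

(* Two intervals at the two ends of an arc are on the same side of it when
   they have the same shade. *)
Definition arc_link : rel interval := [rel i j |
  [exists e : tpoint, [&& arc_touch e i, arc_touch (m e) j
                       & arc_shade i == arc_shade j]]
  || [exists v : option D, exists w : option D,
        (i == arc_star v) && (j == arc_star w)]].

Definition arc_strand := eq_class (frel m).
Definition arc_region := eq_class arc_link.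

Definition arc_side (x : arc_strand) (b : bool) : arc_region :=
  to_class arc_link (odflt (arc_star None)
    [pick i : interval | (arc_shade i == b)
                         && [exists e in sval x, arc_touch e i]]).

Definition arc_tangle : tangle := {|
  disc := D;
  dcol := col;
  strand := arc_strand : finType;
  region := arc_region : finType;
  shade := fun r : arc_region => [exists i in sval r, arc_shade i];
  side := arc_side;
  pt := fun v p => to_class (frel m) (Tagged (fun v => points (col v)) p);
  itv := fun v q => to_class arc_link (Tagged (fun v => intervals (col v)) q) |}.

End ArcTangle.

Definition elim_ord0 (A : Type) (p : 'I_0) : A := False_rect A (notF (ltn_ord p)).

Definition id_tangle (c : color) : tangle :=
  @arc_tangle unit (fun _ => c) (fun e =>
    existT (fun _ => points c) (if tag e is Some _ then None else Some tt)
           (tagged e)).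

Definition empty_tangle (s : bool) : tangle :=
  @arc_tangle void (fun _ => (0%N, s)) id.

(* Two input discs of the same colour, point p of each being joined to point
   2n - 1 - p of the other. *)
Definition pairing_col (c : color) (v : option bool) : color :=
  if v is Some _ then c else (0%N, c.2).
Definition pairing_tangle (c : color) : tangle :=
  @arc_tangle bool (pairing_col c) (fun e =>
    match e with
    | existT (Some b) p =>
        Tagged (fun v => points (pairing_col c v))
               (rev_ord p : points (pairing_col c (Some (~~ b))))
    | existT None p => elim_ord0 _ p
    end).

(* The mirror image: distinguished intervals are kept, numberings reversed. *)
Definition mirror (T : tangle) : tangle := {|
  disc := disc T;
  dcol := dcol T;
  strand := strand T;
  region := region T;
  shade := @shade T;
  side := @side T;
  pt := fun v p => pt v (rev_ord p);
  itv := fun v q => itv v (inord (npoints (dcol T v) - q)%N) |}.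

(* For T whose outer disc has no boundary points: the same picture on the
   sphere with the outer disc (the point at infinity) moved into region r. *)
Definition move_col (T : tangle) (r : region T) (v : option (disc T)) : color :=
  if v is Some d then dcol T (Some d) else (0%N, shade r).
Definition move_outer (T : tangle) (r : region T) : tangle := {|
  disc := disc T;
  dcol := move_col r;
  strand := strand T;
  region := region T;
  shade := @shade T;
  side := @side T;
  pt := fun v : option (disc T) =>
    match v return points (move_col r v) -> strand T with
    | Some d => fun p => pt (Some d) p
    | None => fun p => elim_ord0 _ p
    end;
  itv := fun v : option (disc T) =>
    match v return intervals (move_col r v) -> region T with
    | Some d => fun q => itv (Some d) q
    | None => fun=> r
    end |}.

(* The value of act on incidence data that are not planar is irrelevant: apart
   from multilinearity (which the zero map satisfies), nothing is required of
   it. *)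
Record planar_algebra (F : fieldType) := PlanarAlgebra {
  space : color -> vectType F;
  act : forall T : tangle,
    (forall d : disc T, space (dcol T (Some d))) -> space (dcol T None);
  act_linear : forall (T : tangle)
      (x : forall d : disc T, space (dcol T (Some d))) (d : disc T),
    linear (fun u : space (dcol T (Some d)) => act (dfwith x u));
  act_id : forall (c : color) (x : space c), @act (id_tangle c) (fun=> x) = x;
  act_glue : forall (T S R : tangle) (d : disc T) e f g,
    planar T -> planar S -> @is_glued T S d R e f g ->
    forall (x : forall d : disc T, space (dcol T (Some d)))
           (y : forall d : disc S, space (dcol S (Some d)))
           (z : forall d : disc R, space (dcol R (Some d))),
    Tagged space (x d) = Tagged space (act y) ->
    (forall r t, e (Some r) = inl (Some t) ->
       Tagged space (z r) = Tagged space (x t)) ->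
    (forall r t, e (Some r) = inr (Some t) ->
       Tagged space (z r) = Tagged space (y t)) ->
    Tagged space (act z) = Tagged space (act x) }.
Arguments space {F} p c.
Arguments act {F} p T x.

Section Subfactor.
Variable R : realType.

(* The generator 1 of P_{0,s}, through which closed diagrams are scalars. *)
Definition pa_unit (F : fieldType) (A : planar_algebra F) (s : bool) :
    space A (0%N, s) :=
  act A (empty_tangle s) (fun d : void => match d with end).

(* Finite-dimensionality of the spaces is part of planar_algebra. *)
Record subfactor_planar_algebra := SubfactorPlanarAlgebra {
  pa_of :> planar_algebra R[i];
  star : forall c : color, space pa_of c -> space pa_of c;
  star_semilinear : forall (c : color) (a : R[i]) (x y : space pa_of c),
    star (a *: x + y) = a^* *: star x + star y;
  star_involutive : forall c : color, involutive (@star c);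
  star_act : forall (T : tangle)
      (x : forall d : disc T, space pa_of (dcol T (Some d))),
    planar T ->
    act pa_of (mirror T) (fun d => star (x d)) = star (act pa_of T x);
  dim_zero : forall s : bool, (\dim {: space pa_of (0%N, s)} = 1)%N;
  spherical : forall (T : tangle)
      (x : forall d : disc T, space pa_of (dcol T (Some d)))
      (r r' : region T) (a : R[i]),
    planar T -> (dcol T None).1 = 0%N ->
    act pa_of (move_outer r) x = a *: pa_unit pa_of (shade r) ->
    act pa_of (move_outer r') x = a *: pa_unit pa_of (shade r');
  positive_definite : forall (c : color) (x : space pa_of c), x != 0 ->
    exists2 a : R[i], 0 < a
      & act pa_of (pairing_tangle c) (fun b : bool => if b then star x else x)
        = a *: pa_unit pa_of c.2 }.

End Subfactor.

(* inl a: the point a on the bottom; inr b: the point b on top; both counted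
   from the left. *)
Definition tl_point (i j : nat) : finType := ('I_i.*2 + 'I_j.*2)%type.

(* Position along the boundary of the rectangle, starting at the bottom left
   corner and going through the bottom right one. *)
Definition tl_pos (i j : nat) (x : tl_point i j) : nat :=
  match x with inl a => a | inr b => i.*2 + rev_ord b end.

Definition is_tl (i j : nat) (D : {ffun tl_point i j -> tl_point i j}) : bool :=
  [forall x, (D (D x) == x) && (D x != x)]
  && ~~ [exists x, exists y, [&& tl_pos x < tl_pos y, tl_pos y < tl_pos (D x)
                               & tl_pos (D x) < tl_pos (D y)]]%N.

Definition tl_diagram (i j : nat) :=
  {D : {ffun tl_point i j -> tl_point i j} | is_tl D}.

Definition epi (i j : nat) (D : tl_diagram i j) : bool :=
  [forall b, exists a, val D (inr b) == inl a].

(* No turn-back {c, c'} is enclosed by a turn-back {a, a'}. *)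
Definition non_nested (i j : nat) (D : tl_diagram i j) : bool :=
  [forall a, forall a', forall c, forall c',
    (val D (inl a) == inl a') && (val D (inl c) == inl c')
    ==> ~~ [&& a < c, c < c' & c' < a']]%N.

(* A box of P_{i,k}, read clockwise from its top left corner, has its 2i top
   points first and then its 2k right and left points. *)
Definition box_split (i k : nat) (p : 'I_(i + k).*2) : 'I_i.*2 + 'I_k.*2 :=
  split (cast_ord (doubleD i k) p).
Definition box_join (i k : nat) (u : 'I_i.*2 + 'I_k.*2) : 'I_(i + k).*2 :=
  cast_ord (esym (doubleD i k)) (unsplit u).

Section TLTangle.
Variables (k i j : nat) (D : tl_diagram i j).

Definition tl_col (v : option unit) : color :=
  ((if v is Some _ then i else j) + k, false)%N.
Definition tl_inner (p : 'I_(i + k).*2) : {v & points (tl_col v)} :=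
  existT (fun v => points (tl_col v)) (Some tt) p.
Definition tl_outer (p : 'I_(j + k).*2) : {v & points (tl_col v)} :=
  existT (fun v => points (tl_col v)) None p.

Definition tl_top (x : tl_point i j) : {v & points (tl_col v)} :=
  match x with
  | inl a => tl_inner (box_join (inl a))
  | inr b => tl_outer (box_join (inl b))
  end.

Definition tl_mate (e : {v & points (tl_col v)}) : {v & points (tl_col v)} :=
  match e with
  | existT (Some _) p =>
      match box_split (p : 'I_(i + k).*2) with
      | inl a => tl_top (val D (inl a))
      | inr r => tl_outer (box_join (inr r))
      end
  | existT None p =>
      match box_split (p : 'I_(j + k).*2) with
      | inl b => tl_top (val D (inr b))
      | inr r => tl_inner (box_join (inr r))
      end
  end.

Definition tl_tangle : tangle := arc_tangle tl_mate.

End TLTangle.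

Section DirectSum.
Variables (F : fieldType) (V : nat -> lmodType F).

Record dsum := DSum {
  dcoord : forall n, V n;
  dcoord_fin : exists N, forall n, (N <= n)%N -> dcoord n = 0 }.

Lemma dsumP (u v : dsum) : (forall n, dcoord u n = dcoord v n) -> u = v.
Proof.
case: u v => [u uP] [v vP] /= uv.
have {}uv : u = v by exact: functional_extensionality_dep.
by subst v; congr DSum; exact: Prop_irrelevance.
Qed.

HB.instance Definition _ := gen_eqMixin dsum.
HB.instance Definition _ := gen_choiceMixin dsum.

Lemma dsum0_fin : exists N, forall n, (N <= n)%N -> (fun n => 0 : V n) n = 0.
Proof. by exists 0%N. Qed.
Lemma dsumN_fin (u : dsum) :
  exists N, forall n, (N <= n)%N -> (fun n => - dcoord u n) n = 0.
Proof. by case: (dcoord_fin u) => N uN; exists N => n /uN ->; rewrite oppr0. Qed.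
Lemma dsumD_fin (u v : dsum) :
  exists N, forall n, (N <= n)%N -> (fun n => dcoord u n + dcoord v n) n = 0.
Proof.
case: (dcoord_fin u) (dcoord_fin v) => N uN [M vM]; exists (maxn N M) => n.
by rewrite geq_max => /andP[/uN -> /vM ->]; rewrite addr0.
Qed.
Lemma dsumZ_fin (a : F) (u : dsum) :
  exists N, forall n, (N <= n)%N -> (fun n => a *: dcoord u n) n = 0.
Proof. by case: (dcoord_fin u) => N uN; exists N => n /uN ->; rewrite scaler0. Qed.

Definition dsum0 := DSum dsum0_fin.
Definition dsumN u := DSum (dsumN_fin u).
Definition dsumD u v := DSum (dsumD_fin u v).
Definition dsumZ a u := DSum (dsumZ_fin a u).

Lemma dsum_addA : associative dsumD.
Proof. by move=> u v w; apply: dsumP => n /=; rewrite addrA. Qed.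
Lemma dsum_addC : commutative dsumD.
Proof. by move=> u v; apply: dsumP => n /=; rewrite addrC. Qed.
Lemma dsum_add0 : left_id dsum0 dsumD.
Proof. by move=> u; apply: dsumP => n /=; rewrite add0r. Qed.
Lemma dsum_addN : left_inverse dsum0 dsumN dsumD.
Proof. by move=> u; apply: dsumP => n /=; rewrite addNr. Qed.

HB.instance Definition _ :=
  GRing.isZmodule.Build dsum dsum_addA dsum_addC dsum_add0 dsum_addN.

Lemma dsum_scaleA a b u : dsumZ a (dsumZ b u) = dsumZ (a * b) u.
Proof. by apply: dsumP => n /=; rewrite scalerA. Qed.
Lemma dsum_scale1 : left_id 1 dsumZ.
Proof. by move=> u; apply: dsumP => n /=; rewrite scale1r. Qed.
Lemma dsum_scaleDr : right_distributive dsumZ +%R.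
Proof. by move=> a u v; apply: dsumP => n /=; rewrite scalerDr. Qed.
Lemma dsum_scaleDl u : {morph dsumZ^~ u : a b / a + b}.
Proof. by move=> a b; apply: dsumP => n /=; rewrite scalerDl. Qed.

HB.instance Definition _ := GRing.Zmodule_isLmodule.Build F dsum
  dsum_scaleA dsum_scale1 dsum_scaleDr dsum_scaleDl.

(* The operator with blocks B i j : V i -> V j, for B vanishing when i < j. *)
Section Blocks.
Variable B : forall i j, {linear V i -> V j}.
Hypothesis B_tri : forall i j, (i < j)%N -> forall x, B i j x = 0.

Definition blocks_coord (v : dsum) (j : nat) : V j :=
  \sum_(i \in [set: nat]) B i j (dcoord v i).

Lemma blocks_coordE (v : dsum) (N j : nat) :
    (forall n, (N <= n)%N -> dcoord v n = 0) ->
  blocks_coord v j = \sum_(i < N) B i j (dcoord v i).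
Proof.
move=> vN; rewrite (fsbig_ord _ _ (fun i => B i j (dcoord v i))).
rewrite /blocks_coord; apply/esym/fsbig_widen => // i [_ /= /negP].
by rewrite -leqNgt => /vN ->; rewrite linear0.
Qed.

Lemma blocks_fin (v : dsum) :
  exists N, forall n, (N <= n)%N -> blocks_coord v n = 0.
Proof.
case: (dcoord_fin v) => N vN; exists N => n le_Nn; rewrite (blocks_coordE _ vN).
by apply: big1 => i _; apply: B_tri; apply: leq_trans le_Nn.
Qed.

Definition blocks (v : dsum) : dsum := DSum (blocks_fin v).

Lemma blocks_linear : linear blocks.
Proof.
move=> a u v; apply: dsumP => j /=.
case: (dcoord_fin u) (dcoord_fin v) => N uN [M vM].
have uK n : (maxn N M <= n)%N -> dcoord u n = 0.
  by rewrite geq_max => /andP[/uN].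
have vK n : (maxn N M <= n)%N -> dcoord v n = 0.
  by rewrite geq_max => /andP[_ /vM].
have wK n : (maxn N M <= n)%N -> dcoord (a *: u + v) n = 0.
  by move=> le_n /=; rewrite uK ?vK // scaler0 addr0.
rewrite (blocks_coordE _ uK) (blocks_coordE _ vK) (blocks_coordE _ wK).
by rewrite scaler_sumr -big_split; apply: eq_bigr => i _ /=; rewrite linearP.
Qed.
HB.instance Definition _ := GRing.isLinear.Build F dsum dsum *:%R blocks
  blocks_linear.

End Blocks.
End DirectSum.

Lemma epi_leq (i j : nat) (D : tl_diagram i j) : epi D -> (j <= i)%N.
Proof.
move=> /forallP eD; rewrite -leq_double.
have {}eD b : {a | val D (inr b) = inl a}.
  by apply: cid; have /existsP[a /eqP] := eD b; exists a.
have := @leq_card 'I_j.*2 'I_i.*2 (fun b => sval (eD b)); rewrite !card_ord; apply.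
have DK : involutive (val D).
  by case: D {eD} => D /= /andP[/forallP DK _] x; have /andP[/eqP] := DK x.
move=> b b' /= eq_bb'; have := svalP (eD b); rewrite eq_bb' -(svalP (eD b')).
by move/(inv_inj DK) => -[].
Qed.

Section XY.
Variables (F : fieldType) (A : planar_algebra F) (k : nat).

(* P_{n,k} = P_{n+k}.  P_n stands for the space of discs with 2n boundary
   points whose distinguished interval touches an unshaded region. *)
Definition box (n : nat) : vectType F := space A (n + k, false)%N.

Definition tl_act (i j : nat) (D : tl_diagram i j) (x : box i) : box j :=
  act A (tl_tangle k D) (fun=> x).

Lemma tl_act_linear (i j : nat) (D : tl_diagram i j) : linear (tl_act D).
Proof.
move=> a x y; rewrite /tl_act.
pose Q (d : unit) : Type := space A (dcol (tl_tangle k D) (Some d)).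
pose x0 : forall d, Q d := fun=> 0 : box i.
have cst (z : Q tt) : @dfwith _ Q x0 tt z = fun=> z.
  by apply: functional_extensionality_dep => -[]; exact: (@dfwith_in _ Q).
have /(_ a x y) := @act_linear _ A (tl_tangle k D) x0 tt.
by rewrite !cst.
Qed.
HB.instance Definition _ (i j : nat) (D : tl_diagram i j) :=
  GRing.isLinear.Build F (box i) (box j) *:%R (tl_act D) (tl_act_linear D).

Definition X_block (i j : nat) (x : box i) : box j :=
  \sum_(D : tl_diagram i j | epi D) tl_act D x.

Definition Y_block (i j : nat) (x : box i) : box j :=
  (-1) ^+ (i - j) *: \sum_(D : tl_diagram i j | epi D && non_nested D) tl_act D x.

Lemma X_block_linear (i j : nat) : linear (@X_block i j).
Proof.
move=> a x y; rewrite /X_block scaler_sumr -big_split.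
by apply: eq_bigr => D _; rewrite linearP.
Qed.
HB.instance Definition _ (i j : nat) :=
  GRing.isLinear.Build F (box i) (box j) *:%R (@X_block i j)
    (@X_block_linear i j).

Lemma Y_block_linear (i j : nat) : linear (@Y_block i j).
Proof.
move=> a x y; rewrite /Y_block scalerA mulrC -scalerA -scalerDr; congr (_ *: _).
by rewrite scaler_sumr -big_split; apply: eq_bigr => D _; rewrite linearP.
Qed.
HB.instance Definition _ (i j : nat) :=
  GRing.isLinear.Build F (box i) (box j) *:%R (@Y_block i j)
    (@Y_block_linear i j).

Lemma X_block_tri (i j : nat) : (i < j)%N -> forall x, @X_block i j x = 0.
Proof.
by move=> lt_ij x; apply: big1 => D /epi_leq; rewrite leqNgt lt_ij.
Qed.

Lemma Y_block_tri (i j : nat) : (i < j)%N -> forall x, @Y_block i j x = 0.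
Proof.
move=> lt_ij x; rewrite /Y_block big1 ?scaler0 // => D /andP[/epi_leq].
by rewrite leqNgt lt_ij.
Qed.

Definition P_sum : lmodType F := dsum box.

Definition X : {linear P_sum -> P_sum} :=
  @blocks F box (fun i j => @X_block i j) X_block_tri.

Definition Y : {linear P_sum -> P_sum} :=
  @blocks F box (fun i j => @Y_block i j) Y_block_tri.

End XY.

(* Main.v *)
(* Let C_p be the diagram with a single cap, joining the neighbours p and p + 1.
   Removing the leftmost innermost cap from an epi diagram, or the rightmost cap
   from a non-nested one, factors it as D C_p, with a condition on the caps of D.
   If X_q is the sum of the epi diagrams whose innermost caps start at q or
   later, and Y_q the signed sum of the non-nested ones whose caps start before
   q, this gives X_q = sum_(p >= q) X_(p-1) C_p and
   Y_q = - sum_(p < q) Y_(p-1) C_p, whence X Y_q = X_q by induction; for q large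
   Y_q is Y and X_q is the identity.  As X is unitriangular, it is injective,
   so that XY = 1 implies YX = 1.

   That D C_p acts as the composite rests on the gluing axiom, which needs
   Temperley-Lieb tangles to be planar.  Cutting the annulus between the two
   discs yields a noncrossing matching of points on a circle; a face of it is
   determined by the set of arcs over it, so that a matching with n arcs has
   n + 1 faces.  Undoing the cut multiplies the face permutation by a
   transposition that merges two of them. *)
Require Import Defs.
From mathcomp Require Import all_boot all_order all_algebra.
From mathcomp Require Import all_fingroup boolp reals zify fingraph.

Set Implicit Arguments.
Unset Strict Implicit.
Unset Printing Implicit Defensive.

Import GRing.Theory.
Local Open Scope nat_scope.

(** * Classes and orbits *)

(** Why both recursions carry the index p - 1: once p and p + 1 are removed, their outer neighbours
    become adjacent, at positions p - 1 and p. A cap joining these two encloses the removed cap, so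
    it is not innermost; this is allowed in an epi diagram whose leftmost innermost cap is at p,
    while a cap further left would have come first. In a non-nested diagram it is just that cap
    which is forbidden, and the caps further left are the allowed ones. The two conditions on D are
    thus complementary, with the same threshold. Therefore X Y_q = X_0 - sum_(p < q) X Y_(p-1) C_p =
    X_0 - sum_(p < q) X_(p-1) C_p, and the subtracted terms are exactly the terms with p < q of the
    recursion for X_0; what is left is X_q.

    Since diagrams are taken apart one cap at a time, the only composites to be realised by gluing
    are those of an epi diagram with some C_p. No closed strand arises in them, and the points of
    the glued circle can be moved along the through strands of C_p to the inner disc. *)

Section EqClass.
Variables (T : finType) (r : rel T).
Hypothesis r_sym : connect_sym r.

Lemma to_classP x y : to_class r x = to_class r y <-> connect r x y.
Proof.
split=> [/(congr1 val)/= /setP/(_ y)|xy].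
  by rewrite !inE connect0.
by apply: val_inj; apply/setP => z; rewrite !inE (same_connect r_sym xy).
Qed.

Lemma to_class_surj (X : eq_class r) : exists x, to_class r x = X.
Proof.
by case: X => B /[dup] /imsetP[x _ BE] BP; exists x; exact: val_inj.
Qed.

Definition class_repr (X : eq_class r) : T := sval (cid (to_class_surj X)).

Lemma class_reprK X : to_class r (class_repr X) = X.
Proof. exact: svalP (cid (to_class_surj X)). Qed.

Lemma mem_to_class x y : (y \in sval (to_class r x)) = connect r x y.
Proof. by rewrite inE. Qed.

Lemma card_connect_sets : #|[set [set y | connect r x y] | x : T]| = n_comp r T.
Proof.
pose f x := [set y | connect r x y].
have fE x y : (f x == f y) = connect r x y.
  apply/eqP/idP => [/setP/(_ y)|xy]; first by rewrite !inE connect0.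
  by apply/setP => z; rewrite !inE (same_connect r_sym xy).
have -> : [set f x | x : T] = [set f x | x in [pred x | roots r x]].
  apply/setP => B; apply/imsetP/imsetP => -[x xP ->]; last by exists x.
  exists (root r x); rewrite ?inE ?roots_root //.
  by apply/eqP; rewrite fE connect_root.
rewrite card_in_imset.
  by apply: eq_card => x; rewrite !inE andbT.
move=> x y; rewrite !inE => /eqP rx /eqP ry /eqP; rewrite fE => xy.
by rewrite -rx -ry; apply/(rootP r_sym).
Qed.

Lemma card_eq_class : #|{: eq_class r}| = n_comp r T.
Proof. by rewrite card_sig -card_connect_sets; apply: eq_card => B; rewrite inE. Qed.

(** [Q] is a transversal: it meets every class, and the invariant [L] keeps its elements in distinct
    classes. *)
Lemma n_comp_reps (K : eqType) (L : T -> K) (Q : {set T}) :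
    (forall x y, r x y -> L x = L y) ->
    (forall x, exists2 q, q \in Q & connect r x q) ->
    {in Q &, injective L} ->
  n_comp r T = #|Q|.
Proof.
move=> rL rQ injL.
have cL x y : connect r x y -> L x = L y.
  move=> /connectP[p + ->]; elim: p x => //= z p IH x /andP[/rL -> /IH].
  by [].
rewrite -(@card_in_imset _ _ (root r) (mem Q)).
  apply: eq_card => x; rewrite !inE andbT; apply/idP/imsetP => [/eqP rx|].
    have [q qQ /(rootP r_sym) xq] := rQ x.
    by exists q => //; rewrite -xq rx.
  by case=> q _ ->; rewrite roots_root.
move=> x y xQ yQ /(rootP r_sym)/cL; exact: injL.
Qed.

End EqClass.

Lemma connect_map (T T' : finType) (r : rel T) (r' : rel T') (h : T -> T') :
    (forall x y, r x y -> connect r' (h x) (h y)) ->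
  forall x y, connect r x y -> connect r' (h x) (h y).
Proof.
move=> rh x y /connectP[p + ->]; elim: p x => [|z p IH] x /=; first by rewrite connect0.
by move=> /andP[/rh xz /IH]; exact: connect_trans.
Qed.

(** The maps need only be inverse to each other up to connection. This is the situation of end
    points and intervals below, as a disc without points has an interval that touches no point. *)
Lemma n_comp_equiv (T T' : finType) (r : rel T) (r' : rel T')
    (h : T -> T') (g : T' -> T) :
    connect_sym r -> connect_sym r' ->
    (forall x y, r x y -> connect r' (h x) (h y)) ->
    (forall x y, r' x y -> connect r (g x) (g y)) ->
    (forall x, connect r (g (h x)) x) -> (forall x, connect r' (h (g x)) x) ->
  n_comp r T = n_comp r' T'.
Proof.
move=> rS rS' rh rg gh hg.
rewrite /n_comp_mem -(@card_in_imset _ _ (fun x => root r' (h x))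
                        (predI (roots r) (mem T))).
  apply: eq_card => x; rewrite !inE andbT.
  apply/imsetP/idP => [[y _ ->]|/eqP rx]; first by rewrite roots_root.
  exists (root r (g x)); first by rewrite !inE roots_root.
  rewrite -{1}rx; apply/(rootP rS'); rewrite rS'.
  apply: connect_trans (hg x); apply: (connect_map rh).
  by rewrite rS connect_root.
move=> x y; rewrite !inE !andbT => /eqP rx /eqP ry /(rootP rS') hxy.
rewrite -rx -ry; apply/(rootP rS).
apply: (@connect_trans _ _ (g (h x))); first by rewrite rS gh.
by apply: connect_trans (gh y); apply: (connect_map rg).
Qed.

(** Passage to permutation orbits, where [porbits_mul_tperm] gives the effect of a transposition on
    their number. *)
Lemma card_porbits (T : finType) (s : {perm T}) : #|porbits s| = fcard s T.
Proof.
rewrite -(card_connect_sets (fconnect_sym (@perm_inj _ s))).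
congr #|pred_of_set _|; apply: eq_imset => x; apply/setP => y; rewrite inE.
apply/porbitP/idP => [[i ->]|]; first by rewrite permX fconnect_iter.
by move/iter_findex <-; exists (findex s x y); rewrite permX.
Qed.

Lemma mem_porbitE (T : finType) (s : {perm T}) x y :
  (y \in porbit s x) = fconnect s x y.
Proof.
apply/porbitP/idP => [[i ->]|]; first by rewrite permX fconnect_iter.
by move/iter_findex <-; exists (findex s x y); rewrite permX.
Qed.

(** * Faces of a noncrossing matching of points on a circle *)

Section Matching.
Variables (E : finType) (m : E -> E) (pos : E -> nat).
Hypotheses (mK : involutive m) (m_neq : forall x, m x != x).
Hypotheses (pos_inj : injective pos) (pos_lt : forall x, pos x < #|E|).
Hypothesis pos_surj : forall t, t < #|E| -> exists x, pos x = t.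
Hypothesis ncross : forall x y,
  ~~ [&& pos x < pos y, pos y < pos (m x) & pos (m x) < pos (m y)].

Lemma pos_mate_neq x : pos (m x) != pos x.
Proof. by apply: contraNneq (m_neq x) => /pos_inj ->. Qed.

Definition openers := [set x | pos x < pos (m x)].

Lemma card_openers : #|openers|.*2 = #|E|.
Proof.
rewrite -addnn -{2}(card_imset _ (inv_inj mK)) -(cardsC openers).
congr (_ + _); apply: eq_card => x; rewrite !inE.
apply/imsetP/idP => [[y] |mx]; first by rewrite !inE => ? ->; rewrite mK; lia.
by exists (m x); rewrite ?inE ?mK //; have := pos_mate_neq x; lia.
Qed.

(* The arcs over the gap between the positions t - 1 and t. *)
Definition arcs_over (t : nat) := [set a | pos a < t <= pos (m a)].

(** The gap before [x] and the gap after [m x] lie on the same side of the arc at [x], so that an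
    arc over only one of them would cross it. The instances of [ncross] cover the possible orders of
    the four ends. *)
Lemma arcs_overS x : arcs_over (pos (m x)).+1 = arcs_over (pos x).
Proof.
apply/setP => a; rewrite !inE.
have [->|ax] := eqVneq a x; first by have := pos_mate_neq x; lia.
have [->|amx] := eqVneq a (m x); first by rewrite mK; have := pos_mate_neq x; lia.
have ineq u v : u != v -> pos u != pos v by apply: contraNneq => /pos_inj ->.
have := ineq _ _ ax; have := ineq _ _ amx.
have : pos (m a) != pos x by apply: ineq; apply: contra_neq amx => <-; rewrite mK.
have : pos (m a) != pos (m x) by apply: ineq; apply: contra_neq ax => /(inv_inj mK).
have := ncross a x; have := ncross x a; have := ncross a (m x).
have := ncross (m x) a; have := ncross (m a) x; have := ncross x (m a).
have := ncross (m a) (m x); have := ncross (m x) (m a); rewrite !mK; lia.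
Qed.

Lemma arcs_over0 : arcs_over 0 = set0.
Proof. by apply/setP => a; rewrite !inE. Qed.

Lemma arcs_over_card : arcs_over #|E| = set0.
Proof. by apply/setP => a; rewrite !inE; have := pos_lt (m a); lia. Qed.

(** This recovers an arc from the gap just inside its left end: it is the one that starts furthest
    to the right among the arcs over that gap. *)
Lemma arcs_over_opener a : a \in openers -> a \in arcs_over (pos a).+1 /\
  forall b, b \in arcs_over (pos a).+1 -> pos b <= pos a.
Proof. by rewrite !inE => aP; split=> [|b]; rewrite ?inE; lia. Qed.

Definition next_pt x := odflt x [pick y | pos y == (pos x).+1 %% #|E|].

Lemma pos_next_pt x : pos (next_pt x) = (pos x).+1 %% #|E|.
Proof.
have [|y yx] := @pos_surj ((pos x).+1 %% #|E|).
  by rewrite ltn_mod; have := pos_lt x; lia.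
by rewrite /next_pt; case: pickP => [z /eqP //|/(_ y)]; rewrite yx eqxx.
Qed.

Lemma next_pt_inj : injective next_pt.
Proof.
move=> x y /(congr1 pos); rewrite !pos_next_pt => xy; apply: pos_inj.
have := pos_lt x; have := pos_lt y.
have modE z : pos z < #|E| ->
    (pos z).+1 %% #|E| = if (pos z).+1 == #|E| then 0 else (pos z).+1.
  by move=> zE; case: eqP => [->|]; [rewrite modnn | move=> ?; rewrite modn_small //; lia].
by move: xy; rewrite !modE //; case: eqP; case: eqP; lia.
Qed.

Lemma arcs_over_next x : arcs_over (pos (next_pt x)) = arcs_over (pos x).+1.
Proof.
rewrite pos_next_pt; have [->|xl] := eqVneq (pos x).+1 #|E|.
  by rewrite modnn arcs_over0 arcs_over_card.
by rewrite modn_small //; have := pos_lt x; lia.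
Qed.

(** A point stands for the gap before it. Following the arc at [x] leads from this gap to the gap
    after [m x], which is the one before [face x]; the orbits are the boundary circles of the
    faces. *)
Definition face x := next_pt (m x).

Lemma face_inj : injective face.
Proof. by move=> x y /next_pt_inj/(inv_inj mK). Qed.

Lemma arcs_over_face x : arcs_over (pos (face x)) = arcs_over (pos x).
Proof. by rewrite arcs_over_next arcs_overS. Qed.

Lemma arcs_over_fconnect x y : fconnect face x y -> arcs_over (pos x) = arcs_over (pos y).
Proof. by move/iter_findex <-; elim: findex => //= n ->; rewrite arcs_over_face. Qed.

(** Representatives of the faces are the outermost gap, at [e0], and for each arc the gap just
    inside its left end. The sets of arcs over these gaps are distinct. *)
Lemma fcard_face : 0 < #|E| -> fcard face E = (#|openers|).+1.
Proof.
move=> E0; have [e0 pos0] := pos_surj E0.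
have op_lt a : a \in openers -> pos (next_pt a) = (pos a).+1.
  rewrite inE => aP; rewrite pos_next_pt modn_small //; have := pos_lt (m a); lia.
have -> : (#|openers|).+1 = #|e0 |: [set next_pt a | a in openers]|.
  rewrite cardsU1 (card_imset _ next_pt_inj); suff -> : e0 \notin next_pt @: openers by [].
  by apply/negP => /imsetP[a /op_lt aE e0E]; move: pos0; rewrite e0E aE.
apply: (@n_comp_reps _ _ (fconnect_sym face_inj) _ (fun x => arcs_over (pos x))).
- by move=> x y /eqP <-; rewrite arcs_over_face.
- move=> x; have [n] := ubnP (pos x); elim: n x => // n IH x xn.
  have [x0|x0] := posnP (pos x).
    by exists x; [rewrite !inE (pos_inj (etrans x0 (esym pos0))) eqxx | exact: connect0].
  have [|b bx] := @pos_surj (pos x).-1; first by have := pos_lt x; lia.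
  have nb : next_pt b = x.
    by apply: pos_inj; rewrite pos_next_pt bx prednK // modn_small.
  have [bo|bo] := boolP (b \in openers).
    by exists x; [rewrite !inE -nb imset_f ?orbT | exact: connect0].
  (* Here [b] closes an arc and [face (m b) = x], so the search continues at the left end [m b]. *)
  have [|q qQ mbq] := IH (m b).
    by move: bo; rewrite inE; have := pos_mate_neq b; lia.
  exists q => //; apply: connect_trans mbq; rewrite fconnect_sym; last exact: face_inj.
  by apply: connect1; rewrite /= /face mK nb.
- move=> x y; rewrite !inE.
  have e0P a : a \in openers -> arcs_over (pos e0) <> arcs_over (pos (next_pt a)).
    move=> aP; rewrite pos0 arcs_over0 op_lt // => /setP/(_ a).
    by have [-> _] := arcs_over_opener aP; rewrite inE.
  move=> /orP[/eqP->|/imsetP[a aP ->]] /orP[/eqP->|/imsetP[b bP ->]] //.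
  + by move=> /e0P; case/(_ bP).
  + by move=> /esym/e0P; case/(_ aP).
  rewrite !op_lt // => oab.
  have [aa amax] := arcs_over_opener aP; have [bb bmax] := arcs_over_opener bP.
  congr next_pt; apply: pos_inj; apply/eqP; rewrite eqn_leq.
  by rewrite amax ?oab // bmax -?oab.
Qed.

(* Cutting the circular order at e0 and e1 gives the orders around the two
   discs of an annulus. *)
Section Annulus.
Variables (e0 e1 a : E) (face' : E -> E).
Hypotheses (pos0 : pos e0 = 0) (arcs_over_a : a \in arcs_over (pos e1)).
Hypothesis face'E : forall x, face' x = tperm e0 e1 (face x).

Let s := perm face_inj.
Let t := tperm e0 e1.

Lemma face'_inj : injective face'.
Proof. by move=> x y; rewrite !face'E => /perm_inj/face_inj. Qed.

Let s'E : perm face'_inj = (s * t)%g.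
Proof. by apply/permP => x; rewrite permE permM [s x]permE. Qed.

Let fcard_s : #|porbits s| = fcard face E.
Proof. by rewrite card_porbits; apply: eq_fcard => x; rewrite permE. Qed.

Let fcard_s' : #|porbits (t * s^-1)| = fcard face' E.
Proof.
rewrite -porbitsV invMg invgK tpermV -s'E card_porbits.
by apply: eq_fcard => x; rewrite permE.
Qed.

Let e01 : e0 != e1.
Proof. by apply: contraTneq arcs_over_a => <-; rewrite pos0 arcs_over0 inE. Qed.

(** No arc passes over position 0, but [a] passes over the gap at [e1]; hence [e0] and [e1] are on
    different faces, which the transposition merges. The count is done for inverses because
    [porbits_mul_tperm] multiplies on the left. *)
Lemma fcard_face' : fcard face' E = #|openers|.
Proof.
have := porbits_mul_tperm s^-1 e0 e1; rewrite /= -/t fcard_s' porbitsV fcard_s e01.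
rewrite fcard_face; last by have := pos_lt e0; lia.
rewrite porbitV mem_porbitE.
have -> : fconnect s e1 e0 = false.
  rewrite (eq_fconnect (f' := face)); last by move=> x; rewrite permE.
  apply/negP => /arcs_over_fconnect /setP/(_ a).
  by rewrite arcs_over_a pos0 arcs_over0 inE.
by rewrite addn2 addn1 => -[].
Qed.

(** Applying the transposition a second time undoes the merging. It then increases the number of
    orbits, which requires [e0] and [e1] to be in one orbit. *)
Lemma fconnect_face' : fconnect face' e0 e1.
Proof.
have e0E : 0 < #|E| by have := pos_lt e0; lia.
have := porbits_mul_tperm (t * s^-1)%g e0 e1; rewrite /= -/t mulgA tperm2 mul1g.
rewrite fcard_s' porbitsV fcard_s fcard_face // fcard_face' e01.
case E01: (e0 \in _) => /=; last by lia.
move: E01; rewrite -porbitV invMg invgK tpermV -s'E mem_porbitE => + _.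
rewrite fconnect_sym; last exact: perm_inj.
by rewrite (eq_fconnect (f' := face')) // => x; rewrite permE.
Qed.

End Annulus.
End Matching.

(** * Arc tangles *)

Lemma before_val (c : color) (p : points c) : before p = p :> nat.
Proof. by rewrite inordK //; have := ltn_ord p; lia. Qed.

Lemma after_val (c : color) (p : points c) :
  after p = (if p.+1 == npoints c then 0 else p.+1) :> nat.
Proof.
rewrite /after /inord val_insubd /=; have := ltn_ord p.
by case: eqP; case: (ltnP p.+1 _); lia.
Qed.

Section ArcTangleFacts.
Variables (D : finType) (col : option D -> color).
Local Notation tpoint := {v : option D & points (col v)}.
Local Notation interval := {v : option D & intervals (col v)}.
Local Notation Ival q := (Tagged (fun v => intervals (col v)) q).
Local Notation link := (@arc_link D col).
Variable m : tpoint -> tpoint.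
Hypotheses (mK : involutive m) (m_neq : forall x, m x != x).
Hypothesis col_shade : forall v, (col v).2 = false.
Local Notation T := (arc_tangle m).

Lemma arc_shadeE (i : interval) : arc_shade i = odd (tagged i).
Proof. by rewrite /arc_shade col_shade. Qed.

Lemma touch_before (e : tpoint) : arc_touch e (Ival (before (tagged e))).
Proof. by rewrite /arc_touch eqxx. Qed.

Lemma touch_after (e : tpoint) : arc_touch e (Ival (after (tagged e))).
Proof. by rewrite /arc_touch eqxx orbT. Qed.

Lemma shade_before (e : tpoint) : arc_shade (Ival (before (tagged e))) = odd (tagged e).
Proof. by rewrite arc_shadeE /= before_val. Qed.

Lemma shade_after (e : tpoint) : arc_shade (Ival (after (tagged e))) = ~~ odd (tagged e).
Proof.
rewrite arc_shadeE /= after_val; case: eqP => //= eP.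
by have := congr1 odd eP; rewrite odd_double /= => ->.
Qed.

(** The intervals before and after a point have opposite shades, even where the numbering wraps
    around, so the shade decides between them. *)
Lemma touchP (e : tpoint) i : arc_touch e i ->
  i = Ival (if arc_shade i == odd (tagged e) then before (tagged e)
            else after (tagged e)).
Proof.
case/orP=> /eqP ->; first by rewrite shade_before eqxx.
by rewrite shade_after; case: odd.
Qed.

Lemma touch_inj (e : tpoint) i j :
  arc_touch e i -> arc_touch e j -> arc_shade i = arc_shade j -> i = j.
Proof. by move=> /touchP ei /touchP ej ij; rewrite ei ej ij. Qed.

Lemma touch_ex (e : tpoint) b : exists2 i, arc_touch e i & arc_shade i = b.
Proof.
have [<-|b'] := eqVneq (odd (tagged e)) b.
  by exists (Ival (before (tagged e))); [exact: touch_before|exact: shade_before].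
exists (Ival (after (tagged e))); [exact: touch_after|rewrite shade_after].
by move: b'; case: odd; case: b.
Qed.

Lemma frel_sym : connect_sym (frel m).
Proof. by apply: fconnect_sym; exact: inv_inj. Qed.

Lemma fconnect_invol x y : fconnect m x y = (y == x) || (y == m x).
Proof.
apply/idP/orP => [/iter_findex <-|[/eqP->|/eqP->]]; last exact: fconnect1.
  elim: findex => [|n]; first by left.
  by case=> /eqP /= ->; [right|left; rewrite mK].
exact: connect0.
Qed.

Lemma arc_link_sym : symmetric (arc_link m).
Proof.
move=> i j; apply/idP/idP => /orP[/existsP[e /and3P[ei ej /eqP ij]]|];
  try (by move=> /existsP[v /existsP[w /andP[vi wj]]]; apply/orP; right;
        apply/existsP; exists w; apply/existsP; exists v; rewrite vi wj);
  by apply/orP; left; apply/existsP; exists (m e); rewrite mK ei ej ij eqxx.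
Qed.

Lemma link_sym : connect_sym (arc_link m).
Proof. exact: sym_connect_sym arc_link_sym. Qed.

Lemma touch_link (e : tpoint) i j :
  arc_touch e i -> arc_touch (m e) j -> arc_shade i = arc_shade j ->
  connect (arc_link m) i j.
Proof.
move=> ei ej ij; apply: connect1; apply/orP; left.
by apply/existsP; exists e; rewrite ei ej ij eqxx.
Qed.

Lemma star_link v w : connect (arc_link m) (arc_star col v) (arc_star col w).
Proof.
apply: connect1; apply/orP; right.
by apply/existsP; exists v; apply/existsP; exists w; rewrite !eqxx.
Qed.

Lemma link_ind (P : interval -> interval -> Prop) :
    (forall e i j, arc_touch e i -> arc_touch (m e) j ->
       arc_shade i = arc_shade j -> P i j) ->
    (forall v w, P (arc_star col v) (arc_star col w)) ->
  forall i j, arc_link m i j -> P i j.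
Proof.
move=> Pt Ps i j /orP[/existsP[e /and3P[ei ej /eqP ij]]|]; first exact: Pt ei ej ij.
by case/existsP=> v /existsP[w /andP[/eqP -> /eqP ->]].
Qed.

Lemma arc_star_shade v : arc_shade (arc_star col v) = false.
Proof. by rewrite arc_shadeE. Qed.

Lemma connect_shade i j : connect (arc_link m) i j -> arc_shade i = arc_shade j.
Proof.
have h : forall i j, arc_link m i j -> arc_shade i = arc_shade j.
  by apply: link_ind => // v w; rewrite !arc_star_shade.
move=> /connectP[p + ->]; elim: p i => //= z p IH i /andP[/h -> /IH]; exact.
Qed.

(** [arc_side] picks some interval of shade [b] at either end of the strand. At [e] the shade leaves
    only [i], and an interval at [m e] is linked to [i], so the region does not depend on the
    choice. *)
Lemma arc_sideE (e : tpoint) i b : arc_touch e i -> arc_shade i = b ->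
  arc_side (to_class (frel m) e) b = to_class (arc_link m) i.
Proof.
move=> ei ib; rewrite /arc_side; case: pickP => [j|/(_ i)] /=; last first.
  rewrite ib eqxx /= => /negbT/negP[]; apply/existsP; exists e.
  by rewrite mem_to_class connect0.
case/andP=> /eqP jb /existsP[e' /andP[]]; rewrite mem_to_class fconnect_invol.
case/orP=> /eqP -> ej.
  by rewrite (touch_inj ej ei) // jb ib.
apply/(to_classP link_sym); rewrite link_sym; apply: (touch_link ei ej).
by rewrite ib jb.
Qed.

Lemma arc_mate (e : Defs.tpoint T) : mate e = m e.
Proof.
have eqS (x y : tpoint) :
    (to_class (frel m) y == to_class (frel m) x) = (y == x) || (y == m x).
  rewrite -fconnect_invol frel_sym; apply/eqP/idP => [/(to_classP frel_sym) //|].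
  by move=> /(to_classP frel_sym).
have sE (x : Defs.tpoint T) : strand_of x = to_class (frel m) x by case: x.
rewrite /mate; case: pickP => [e' /andP[ee']|/(_ (m e))].
  by rewrite !sE eqS (negPf ee') => /eqP.
by rewrite !sE eqS m_neq eqxx orbT.
Qed.

Lemma arc_planar_before v (p : points (col v)) :
  arc_side (to_class (frel m) (Tagged _ p)) (odd p)
    = to_class (arc_link m) (Ival (before p)).
Proof.
apply: (@arc_sideE (Tagged (fun v => points (col v)) p)).
  exact: (touch_before (Tagged (fun v => points (col v)) p)).
exact: (shade_before (Tagged (fun v => points (col v)) p)).
Qed.

Lemma arc_planar_after v (p : points (col v)) :
  arc_side (to_class (frel m) (Tagged _ p)) (~~ odd p)
    = to_class (arc_link m) (Ival (after p)).
Proof.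
apply: (@arc_sideE (Tagged (fun v => points (col v)) p)).
  exact: (touch_after (Tagged (fun v => points (col v)) p)).
exact: (shade_after (Tagged (fun v => points (col v)) p)).
Qed.

Lemma arc_region_shade i : @shade T (to_class (arc_link m) i) = arc_shade i.
Proof.
apply/existsP/idP => [[j]|ib].
  by rewrite mem_to_class => /andP[/connect_shade ->].
by exists i; rewrite mem_to_class connect0.
Qed.

Lemma arc_point_shade v p : point_shade (T := T) v p = odd p.
Proof. by rewrite /point_shade /= col_shade. Qed.

Hypothesis m_outgoing :
  forall e : Defs.tpoint T, outgoing (m e : Defs.tpoint T) = ~~ outgoing e.
Hypothesis euler :
  (#|{: option D}| + 2 * n_comp (arc_link m) {: interval} =
   2 + \sum_(v : option D) (col v).1 + fcard (@turn T \o m) {: tpoint}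
   + #|[pred v : option D | (col v).1 == 0]|).

(** The shading and incidence conditions hold by the construction of the links; only [m_outgoing]
    and [euler] depend on how the arcs are drawn. *)
Lemma arc_planar : planar T.
Proof.
split.
- by move=> v q; rewrite arc_region_shade arc_point_shade arc_shadeE.
- move=> x b; have [e <-] := to_class_surj x.
  by have [i ei ib] := touch_ex e b; rewrite [side _ _](arc_sideE ei ib) arc_region_shade.
- by move=> v p; rewrite arc_point_shade; exact: arc_planar_before.
- by move=> v p; rewrite arc_point_shade; exact: arc_planar_after.
(* The value [true] stands for one end: [e1] is the end of the arc with orientation [b]. *)
- move=> x; exists true => b; have [e <-] := to_class_surj x.
  pose e1 : Defs.tpoint T := if outgoing (e : Defs.tpoint T) == b then e else m e.
  apply: (etrans _ (card1 e1)); apply: eq_card => e'; rewrite !inE /strand_of.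
  have -> : (pt (tag e') (tagged e') == to_class (frel m) e) = (e' == e) || (e' == m e).
    rewrite -fconnect_invol frel_sym; case: (e') => v p /=.
    by apply/eqP/idP => /(to_classP frel_sym).
  rewrite /e1; have [<-|ne] := eqVneq (outgoing (e : Defs.tpoint T)) b.
    have [->|e'e] := eqVneq e' e; first by rewrite eqxx.
    by have [->|//] := eqVneq e' (m e); rewrite m_outgoing; case: outgoing.
  have [->|e'e] := eqVneq e' (m e).
    by rewrite m_outgoing orbT; move: ne; case: outgoing; case: (b).
  by have [->|//] := eqVneq e' e; rewrite (negPf ne).
- move=> r r'.
  (* Walking around a disc from interval [q] back to interval 0 crosses one strand at a time, and
     the distinguished intervals of all discs lie in one region. *)
  have star v (q : intervals (col v)) :
      connect (@adjacent T) (to_class (arc_link m) (Ival q))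
        (to_class (arc_link m) (arc_star col v)) /\
      connect (@adjacent T) (to_class (arc_link m) (arc_star col v))
        (to_class (arc_link m) (Ival q)).
    case: q => q; elim: q => [|q IH] qP.
      by rewrite /arc_star (_ : Ordinal qP = ord0); [split; exact: connect0|exact: val_inj].
    have qP' : q < (npoints (col v)).-1.+1 by lia.
    have qP2 : q < npoints (col v) by lia.
    pose p : points (col v) := Ordinal qP2.
    have pb : Ordinal qP' = before p by apply: val_inj; rewrite /= before_val.
    have pa : Ordinal qP = after p.
      by apply: val_inj; rewrite /= after_val /=; case: eqP => //; lia.
    have [IH1 IH2] := IH qP'; move: IH1 IH2; rewrite pb pa => IH1 IH2.
    have adj b : adjacent (side (@pt T v p) b) (side (@pt T v p) (~~ b)).
      by apply/existsP; exists (@pt T v p); apply/existsP; exists b; rewrite !eqxx.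
    move: (adj (odd p)) (adj (~~ odd p)); rewrite negbK.
    rewrite [side _ (odd p)]arc_planar_before [side _ (~~ odd p)]arc_planar_after.
    move=> adj1 adj2; split.
      exact: connect_trans (connect1 adj2) IH1.
    exact: connect_trans IH2 (connect1 adj1).
  have [[v q] <-] := to_class_surj r; have [[w q'] <-] := to_class_surj r'.
  apply: connect_trans (proj1 (star v q)) _; apply: connect_trans (proj2 (star w q')).
  by rewrite (proj2 (to_classP link_sym _ _) (star_link v w)) connect0.
- rewrite /narcs /nboundaries [#|region T|](card_eq_class link_sym) euler.
  rewrite (_ : #|[pred x | closed_strand x]| = 0).
    rewrite (@eq_fcard _ (@turn T \o @mate T) (@turn T \o m)) /=.
      by rewrite ?muln0 ?addn0 !addnA.
    by move=> e; rewrite /= arc_mate.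
  apply: eq_card0 => x; rewrite !inE; apply/negbTE/forallPn.
  by have [e <-] := to_class_surj x; exists e; rewrite negbK; case: (e).
Qed.

End ArcTangleFacts.

(** * Planarity of noncrossing annular matchings *)

Section Parity.
Variables (E : finType) (m : E -> E) (pos : E -> nat).
Hypotheses (mK : involutive m) (m_neq : forall x, m x != x).
Hypotheses (pos_inj : injective pos) (pos_lt : forall x, pos x < #|E|).
Hypothesis pos_surj : forall t, t < #|E| -> exists x, pos x = t.
Hypothesis ncross : forall x y,
  ~~ [&& pos x < pos y, pos y < pos (m x) & pos (m x) < pos (m y)].

(** Passing the point at position [t] opens or closes exactly one arc. *)
Lemma odd_card_over t : t <= #|E| -> odd #|arcs_over m pos t| = odd t.
Proof.
elim: t => [|t IH] tE; first by rewrite arcs_over0 cards0.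
have [x xt] := pos_surj tE; have := pos_mate_neq m_neq pos_inj x.
rewrite /= -IH; last exact: ltnW.
have ineq y : pos y = t -> y = x by rewrite -xt => /pos_inj.
rewrite xt neq_ltn => /orP[mx|mx].
  have -> : arcs_over m pos t = m x |: arcs_over m pos t.+1.
    apply/setP => a; rewrite !inE; have [->|am] := eqVneq a (m x).
      by rewrite mK; lia.
    have : pos (m a) <> t by move=> /ineq; apply/eqP; apply: contra_neq am => <-; rewrite mK.
    have [->|ax] := eqVneq a x; first by lia.
    by have : pos a <> t by [move=> /ineq; apply/eqP]; lia.
  by rewrite cardsU1 inE mK xt ltnn andbF /= negbK.
have -> : arcs_over m pos t.+1 = x |: arcs_over m pos t.
  apply/setP => a; rewrite !inE; have [->|ax] := eqVneq a x; first by lia.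
  have : pos a <> t by move=> /ineq; apply/eqP.
  have [->|am] := eqVneq a (m x); first by rewrite mK; lia.
  have : pos (m a) <> t by move=> /ineq; apply/eqP; apply: contra_neq am => <-; rewrite mK.
  by lia.
by rewrite cardsU1 inE xt ltnn.
Qed.

(** By [arcs_overS] the gaps numbered [pos x] and [(pos (m x)).+1] have the same arcs over them,
    hence the same parity. This is what makes the shading and the orientation of the strands
    consistent. *)
Lemma odd_pos_mate x : odd (pos (m x)) = ~~ odd (pos x).
Proof.
rewrite -[odd (pos x)]odd_card_over; last exact: ltnW.
by rewrite -(arcs_overS mK m_neq pos_inj ncross) odd_card_over //= negbK.
Qed.

End Parity.

Lemma big_option_unit (F : option unit -> nat) :
  \sum_(v : option unit) F v = F None + F (Some tt).
Proof.
rewrite (bigD1 None) // (bigD1 (Some tt)) //= big1 ?addn0 //.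
by case=> [[]|].
Qed.

Lemma modn_pred_cycle p n : p < n ->
  (p + n).-1 %% n = if p == 0 then n.-1 else p.-1.
Proof.
case: p => [|p] pn /=; first by rewrite modn_small // prednK.
by rewrite modnDr modn_small // ltnW.
Qed.

Section AnnularPlanar.
Variables (col : option unit -> color).
Local Notation tpoint := {v : option unit & points (col v)}.
Local Notation interval := {v : option unit & intervals (col v)}.
Local Notation Ival q := (Tagged (fun v => intervals (col v)) q).
Local Notation Pt p := (Tagged (fun v => points (col v)) p).
Variable m : tpoint -> tpoint.
Hypotheses (mK : involutive m) (m_neq : forall x, m x != x).
Hypothesis col_shade : forall v, (col v).2 = false.
Local Notation T := (arc_tangle m).
Local Notation n1 := (npoints (col (Some tt))).
Local Notation n2 := (npoints (col None)).

(* The order obtained by cutting the annulus along an arc that joins the two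
   distinguished intervals: the inner points come first, then the outer ones
   counterclockwise. *)
Definition annular_pos (e : tpoint) : nat :=
  if tag e is Some _ then tagged e else (n1 + n2).-1 - tagged e.
Local Notation pos := annular_pos.

Hypothesis ncross : forall x y,
  ~~ [&& pos x < pos y, pos y < pos (m x) & pos (m x) < pos (m y)].
(** A strand between the two discs passes over the gap at [n1], whereas no arc passes over position
    0. The two sides of the cut thus lie on different faces. *)
Hypothesis through : 0 < n2 -> exists a, pos a < n1 <= pos (m a).

Lemma card_tpoint : #|{: tpoint}| = n1 + n2.
Proof.
rewrite card_tagged sumnE big_map big_enum /= big_option_unit !card_ord addnC.
by [].
Qed.

Lemma annular_pos_inj : injective pos.
Proof.
rewrite /pos => -[[[]|] p] [[[]|] q] /=; have := ltn_ord p; have := ltn_ord q => qP pP pq.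
- by congr existT; apply: val_inj.
- by exfalso; move: pq qP pP => /=; lia.
- by exfalso; move: pq qP pP => /=; lia.
- by congr existT; apply: val_inj; move: pq qP pP => /=; lia.
Qed.

Lemma annular_pos_lt e : pos e < #|{: tpoint}|.
Proof.
rewrite card_tpoint /pos; case: e => -[[]|] p /=; have := ltn_ord p; lia.
Qed.

Lemma annular_pos_surj t : t < #|{: tpoint}| -> exists e, pos e = t.
Proof.
rewrite card_tpoint => tn; have [t1|t1] := ltnP t n1.
  by exists (Pt (Ordinal t1 : points (col (Some tt)))).
have t2 : (n1 + n2).-1 - t < n2 by lia.
by exists (Pt (Ordinal t2 : points (col None))); rewrite /pos /=; lia.
Qed.

Let pos_mate := odd_pos_mate mK m_neq annular_pos_inj annular_pos_lt
  annular_pos_surj ncross.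

Lemma annular_outgoing (e : Defs.tpoint T) : outgoing e = odd (pos e).
Proof.
rewrite /outgoing arc_point_shade // /pos; case: e => -[[]|] p //=.
rewrite oddB; last by have /= := ltn_ord p; lia.
have := ltn_ord p; case: ((col None).1) (p) => [[]//|n'] {}p _.
by rewrite -doubleD addnS /= odd_double.
Qed.

Lemma annular_m_outgoing (e : Defs.tpoint T) :
  outgoing (m e : Defs.tpoint T) = ~~ outgoing e.
Proof. by rewrite !annular_outgoing pos_mate. Qed.

(* The order annular_pos runs backwards along the outer disc, which exchanges
   before and after there. *)
Definition gap_before (e : tpoint) : interval :=
  Ival (if tag e then before (tagged e) else after (tagged e)).
Definition gap_after (e : tpoint) : interval :=
  Ival (if tag e then after (tagged e) else before (tagged e)).

Lemma touch_gap_before e : arc_touch e (gap_before e).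
Proof. by rewrite /gap_before; case: ifP => _; [exact: touch_before|exact: touch_after]. Qed.

Lemma touch_gap_after e : arc_touch e (gap_after e).
Proof. by rewrite /gap_after; case: ifP => _; [exact: touch_after|exact: touch_before]. Qed.

Lemma shade_gap_before e : arc_shade (gap_before e) = odd (pos e).
Proof.
rewrite -annular_outgoing /outgoing arc_point_shade // /gap_before.
case: e => -[[]|] p /=.
  exact: (shade_before col_shade (Pt (p : points (col (Some tt))))).
exact: (shade_after col_shade (Pt (p : points (col None)))).
Qed.

Lemma shade_gap_after e : arc_shade (gap_after e) = ~~ odd (pos e).
Proof.
rewrite -annular_outgoing /outgoing arc_point_shade // /gap_after.
case: e => -[[]|] p /=.
  exact: (shade_after col_shade (Pt (p : points (col (Some tt))))).
by rewrite negbK; exact: (shade_before col_shade (Pt (p : points (col None)))).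
Qed.

Lemma gap_turn (e : tpoint) : gap_before (@turn T e) = gap_after e.
Proof.
case: e => -[[]|] p; rewrite /gap_before /gap_after /=; congr existT; apply: val_inj;
  rewrite /= before_val after_val /=; have := ltn_ord p => /= pn.
  by case: eqP => [->|?]; [rewrite modnn | rewrite modn_small //; lia].
rewrite modn_pred_cycle //; have [z|z] := eqVneq (p : nat) 0;
  by do 2?[case: eqP => ?]; lia.
Qed.

Lemma gap_before_inj : injective gap_before.
Proof.
rewrite /gap_before => -[[[]|] p] [[[]|] q] //= /eqP; rewrite eq_Tagged /= -val_eqE /=.
  by rewrite !before_val => /eqP pq; congr existT; apply: val_inj.
have := ltn_ord p; have := ltn_ord q => /= pn qn.
rewrite !after_val => /eqP pq; congr existT; apply: val_inj => /=.
by move: pq; do 2?[case: eqP => ?]; lia.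
Qed.

Lemma gap_before_surj (i : interval) :
  (exists e, gap_before e = i) \/ npoints (col (tag i)) = 0.
Proof.
have [|n0] := posnP (npoints (col (tag i))); [by right|left].
case: i n0 => -[[]|] q /= n0; have /= qn := ltn_ord q.
  have qn' : q < npoints (col (Some tt)) by lia.
  exists (Pt (Ordinal qn' : points (col (Some tt)))).
  by rewrite /gap_before /=; congr existT; apply: val_inj; rewrite /= before_val.
have qn' : (q + npoints (col None)).-1 %% npoints (col None) < npoints (col None).
  by rewrite ltn_mod.
exists (Pt (Ordinal qn' : points (col None))).
rewrite /gap_before /=; congr existT; apply: val_inj; rewrite /= after_val /=.
rewrite modn_pred_cycle //; have [z|z] := eqVneq (q : nat) 0;
  by do 2?[case: eqP => ?]; lia.
Qed.

(** [turn] closes up each disc separately, while the cyclic successor [next_pt] runs on from the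
    inner disc to the outer one and back. If the outer disc has points, the two differ by exchanging
    the points at positions 0 and [n1]. *)
Lemma annular_turn (e : tpoint) :
  pos (@turn T e) = if (pos e).+1 == n1 then 0
                    else if (pos e).+1 == n1 + n2 then n1 else (pos e).+1.
Proof.
rewrite /pos; case: e => -[[]|] p /=; have := ltn_ord p => /= pn.
  case: eqP => [->|?]; first by rewrite modnn.
  by rewrite modn_small; [case: eqP; lia|lia].
rewrite modn_pred_cycle //; have [z|z] := eqVneq (p : nat) 0;
  by do 3?[case: eqP => ?]; lia.
Qed.

Let pos_next_pt := pos_next_pt annular_pos_lt annular_pos_surj.

Lemma n2_le : 0 < n2 -> 0 < n1.
Proof. by case/through=> a; lia. Qed.

(** With points on both discs, undoing the cut merges two of the faces. Without outer points there
    is only one circle and [turn] agrees with [next_pt], so no face is lost; hence the summand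
    [n2 == 0]. *)
Lemma annular_fcard : 0 < n1 ->
  fcard (@turn T \o m) {: tpoint} = (#|openers m pos| + (n2 == 0)) /\
  (forall e0 e1, pos e0 = 0 -> pos e1 = n1 -> fconnect (@turn T \o m) e0 e1).
Proof.
move=> n1P; have cE := card_tpoint.
have [n20|n2P] := posnP n2.
  split; last first.
    move=> e0 e1 _ e1P; have := annular_pos_lt e1.
    by rewrite cE e1P n20 addn0 ltnn.
  rewrite addn1 -(fcard_face mK m_neq annular_pos_inj annular_pos_lt
    annular_pos_surj ncross) ?cE ?addn_gt0 ?n1P //.
  apply: eq_fcard => e; rewrite /face /=; apply: annular_pos_inj.
  rewrite annular_turn pos_next_pt cE n20 addn0; case: eqP => [->|neq]; first by rewrite modnn.
  by rewrite modn_small //; have := annular_pos_lt (m e); rewrite cE n20; lia.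
have [a aP] := through n2P.
have E12 e0 e1 : pos e0 = 0 -> pos e1 = n1 ->
    (forall x, (@turn T \o m) x = tperm e0 e1 (face m pos x)).
  move=> e0P e1P x; rewrite /face /=; apply: annular_pos_inj.
  have := annular_pos_lt (m x); rewrite cE => mx.
  have nx := pos_next_pt (m x); rewrite annular_turn; move: nx; rewrite cE => nx.
  case: tpermP => [ne|ne|ne0 ne1].
  - rewrite ne e0P in nx; rewrite e1P.
    have : (pos (m x)).+1 = n1 + n2.
      apply/eqP; case: eqP => // neq; move: nx; rewrite modn_small; lia.
    by do 2?[case: eqP => ?]; lia.
  - rewrite ne e1P in nx; rewrite e0P.
    have : (pos (m x)).+1 = n1.
      move: nx; have [->|neq] := eqVneq (pos (m x)).+1 (n1 + n2); first by rewrite modnn; lia.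
      by rewrite modn_small; lia.
    by move=> ->; rewrite eqxx.
  - have p0 : pos (next_pt pos (m x)) != 0.
      by apply/eqP => p0; apply: ne0; apply: annular_pos_inj; rewrite p0.
    have p1 : pos (next_pt pos (m x)) != n1.
      by apply/eqP => p1; apply: ne1; apply: annular_pos_inj; rewrite p1.
    move: nx; have [E|neq] := eqVneq (pos (m x)).+1 (n1 + n2).
      by rewrite E modnn => p0'; rewrite p0' in p0.
    by rewrite modn_small; [|lia] => nx; case: eqP; lia.
have ov e1 : pos e1 = n1 -> a \in arcs_over m pos (pos e1) by rewrite inE => ->.
split; last first.
  move=> e0 e1 e0P e1P.
  exact: (fconnect_face' mK m_neq annular_pos_inj annular_pos_lt annular_pos_surj
            ncross e0P (ov _ e1P) (E12 _ _ e0P e1P)).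
have [e0 e0P] : exists e, pos e = 0 by apply: annular_pos_surj; rewrite cE; lia.
have [e1 e1P] : exists e, pos e = n1 by apply: annular_pos_surj; rewrite cE; lia.
rewrite (fcard_face' mK m_neq annular_pos_inj annular_pos_lt annular_pos_surj
            ncross e0P (ov _ e1P) (E12 _ _ e0P e1P)).
by rewrite addn0.
Qed.

(** Under [gap_before], a link along an arc is a step of [turn \o m], forwards or backwards. The
    links between distinguished intervals merge nothing further: these intervals belong to [e0] and
    [e1], which share a cycle by [annular_fcard]. *)
Lemma annular_n_comp : 0 < n1 ->
  n_comp (arc_link m) {: interval} = fcard (@turn T \o m) {: tpoint}.
Proof.
move=> n1P; have [_ e01] := annular_fcard n1P.
have [e0 e0P] : exists e, pos e = 0 by apply: annular_pos_surj; rewrite card_tpoint; lia.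
have e0star : gap_before e0 = arc_star col (Some tt).
  move: e0P; rewrite /pos /gap_before; case: e0 => -[[]|] p /= p0.
    by congr existT; apply: val_inj; rewrite /= before_val.
  by have /= := ltn_ord p; lia.
(* The default serves the interval of an outer disc without points, which is linked to the
   distinguished interval of the inner disc, the one before [e0]. *)
pose g i := odflt e0 [pick e | gap_before e == i].
have gh e : g (gap_before e) = e.
  by rewrite /g; case: pickP => [e' /eqP/gap_before_inj|/(_ e)] //; rewrite eqxx.
have turn_inj : injective (@turn T \o m).
  move=> x y /= xy; apply: (inv_inj mK).
  have : gap_after (m x) = gap_after (m y) by rewrite -!gap_turn xy.
  rewrite /gap_after; case: (m x) => -[[]|] p; case: (m y) => -[[]|] q //= /eqP;
    rewrite eq_Tagged /= -val_eqE /= ?before_val ?after_val => /eqP pq;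
    congr existT; apply: val_inj => //=; have /= := ltn_ord p; have /= := ltn_ord q.
  by move: pq; do 2?[case: eqP => ?]; lia.
apply/esym; apply: (n_comp_equiv (h := gap_before) (g := g)).
- exact: fconnect_sym.
- exact: link_sym.
- move=> x y /eqP <-; rewrite /= gap_turn.
  apply: (touch_link (touch_gap_before x) (touch_gap_after (m x))).
  by rewrite shade_gap_before shade_gap_after pos_mate negbK.
- apply: link_ind => [e i j ei ej ij|v w].
    have [ie|ie] := eqVneq (arc_shade i) (odd (pos e)).
      have -> : i = gap_before e.
        by apply: (touch_inj col_shade ei (touch_gap_before e)); rewrite shade_gap_before.
      have -> : j = gap_after (m e).
        apply: (touch_inj col_shade ej (touch_gap_after _)).
        by rewrite shade_gap_after pos_mate negbK -ij.
      by rewrite -gap_turn !gh fconnect1.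
    (* On this side of the arc the link runs against the cycle, from [gap_after e] to
       [gap_before (m e)]. *)
    have -> : i = gap_after e.
      apply: (touch_inj col_shade ei (touch_gap_after e)).
      by rewrite shade_gap_after; move: ie; case: arc_shade; case: odd.
    have -> : j = gap_before (m e).
      apply: (touch_inj col_shade ej (touch_gap_before _)).
      by rewrite shade_gap_before pos_mate -ij; move: ie; case: arc_shade; case: odd.
    rewrite -gap_turn !gh fconnect_sym //.
    by have := fconnect1 (@turn T \o m) (m e); rewrite /= mK.
  have gs u : fconnect (@turn T \o m) e0 (g (arc_star col u)).
    case: u => [[]|]; first by rewrite -e0star gh connect0.
    rewrite /g; case: pickP => [e1 /eqP e1E|_]; last exact: connect0.
    apply: e01 => //; move: e1E; rewrite /gap_before /pos; case: e1 => -[[]|] p //=.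
    move=> /eqP; rewrite eq_Tagged /= -val_eqE /= after_val => /eqP; have /= := ltn_ord p.
    have arith (a b q : nat) : q.+1 = b -> (a + b).-1 - q = a by lia.
    by case: (p.+1 =P _) => // pE _ _; apply: arith.
  by apply: connect_trans (gs w); rewrite fconnect_sym.
- by move=> e; rewrite gh connect0.
- move=> i; rewrite /g; case: pickP => [e /eqP -> //|noe] /=.
  rewrite e0star; case: (gap_before_surj i) => [[e ei]|].
    by have := noe e; rewrite ei eqxx.
  case: i {noe} => -[[]|] q /= n0; first by move: n1P; rewrite n0.
  suff -> : existT (fun v => intervals (col v)) None q = arc_star col None by exact: star_link.
  by congr existT; apply: val_inj => /=; have /= := ltn_ord q; lia.
Qed.

Lemma annular_planar : planar T.
Proof.
apply: arc_planar => //; first exact: annular_m_outgoing.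
have -> : #|[pred v | (col v).1 == 0]| = (n1 == 0) + (n2 == 0).
  rewrite -sum1_card big_mkcond big_option_unit /= !inE !double_eq0.
  by rewrite addnC; do 2!case: (_ == 0).
rewrite card_option card_unit big_option_unit.
(* Without inner points [through] excludes outer ones, and there remain a single region and two
   discs without points. *)
have [n10|n1P] := posnP n1.
  have n20 : n2 = 0 by have := n2_le; lia.
  have -> : n_comp (arc_link m) {: interval} = 1.
    rewrite (n_comp_reps (@link_sym _ _ _ mK) (L := fun=> tt)
      (Q := [set arc_star col None])).
    - exact: cards1.
    - by [].
    - move=> i; exists (arc_star col None); first by rewrite inE.
      suff -> : i = arc_star col (tag i) by exact: star_link.
      case: i => v q; congr existT; apply: val_inj => /=.
      by have /= := ltn_ord q; case: v q => [[]|] q /=; lia.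
    by move=> x y; rewrite !inE => /eqP -> /eqP ->.
  have -> : fcard (@turn T \o m) {: tpoint} = 0.
    by apply: eq_card0 => e; have := annular_pos_lt e; rewrite card_tpoint n10 n20.
  by rewrite n20; lia.
rewrite annular_n_comp // (proj1 (annular_fcard n1P)).
have := card_openers mK m_neq annular_pos_inj; rewrite card_tpoint.
by case: (n2 == 0); lia.
Qed.

End AnnularPlanar.

(** * Temperley-Lieb diagrams *)

Section Diagrams.
Variables (i j : nat).
Implicit Types (D : tl_diagram i j) (x y : tl_point i j) (a b : 'I_i.*2).

Lemma tl_pos_inj : injective (@tl_pos i j).
Proof.
move=> [a|a] [b|b] /=; have /= := ltn_ord a; have /= := ltn_ord b => bi ai ab.
- by congr inl; apply: val_inj.
- by exfalso; lia.
- by exfalso; lia.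
- by congr inr; apply: val_inj => /=; lia.
Qed.

Lemma tlK D : involutive (val D).
Proof. by case: D => D /= /andP[/forallP DK _] x; case/andP: (DK x) => /eqP. Qed.

Lemma tl_neq D x : val D x != x.
Proof. by case: D => D /= /andP[/forallP DK _]; case/andP: (DK x). Qed.

Lemma tl_ncross D x y :
  ~~ [&& tl_pos x < tl_pos y, tl_pos y < tl_pos (val D x)
      & tl_pos (val D x) < tl_pos (val D y)].
Proof.
case: D => D /= /andP[_]; apply: contra => xy.
by apply/existsP; exists x; apply/existsP; exists y.
Qed.

Lemma is_tlP (f : {ffun tl_point i j -> tl_point i j}) :
    involutive f -> (forall x, f x != x) ->
    (forall x y, ~~ [&& tl_pos x < tl_pos y, tl_pos y < tl_pos (f x)
                     & tl_pos (f x) < tl_pos (f y)]) ->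
  is_tl f.
Proof.
move=> fK f_neq f_nc; apply/andP; split.
  by apply/forallP => x; rewrite fK eqxx f_neq.
by apply/existsPn => x; apply/existsPn => y.
Qed.

Lemma tl_diagram_eq D D' : (forall x, val D x = val D' x) -> D = D'.
Proof. by move=> DD'; apply: val_inj; apply/ffunP. Qed.

(* By planarity, the cap at the point following a stays below the cap at a. *)
Lemma cap_inside D a b : val D (inl a) = inl b -> a < b -> b <> a.+1 :> nat ->
  exists c d, [/\ val D (inl c) = inl d, a < c, c < d & d < b].
Proof.
move=> ab ltab nab; have ci : a.+1 < i.*2 by have := ltn_ord b; lia.
pose c : 'I_i.*2 := Ordinal ci.
case E: (val D (inl c)) => [d|d]; last first.
  by have := tl_ncross D (inl a) (inl c); rewrite ab E /= ltnSn; have := ltn_ord b; lia.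
have ca : d <> a.
  by move=> da; move: (tlK D (inl c)); rewrite E da ab => -[] /(congr1 val) /=; lia.
have cb : d <> b.
  by move=> db; move: (tlK D (inl c)); rewrite E db -ab tlK => -[] /(congr1 val) /=; lia.
have cc : d <> c by move=> dc; move: (tl_neq D (inl c)); rewrite E dc eqxx.
have pa : (d : nat) <> a by move=> e; apply: ca; exact: val_inj.
have pb : (d : nat) <> b by move=> e; apply: cb; exact: val_inj.
have pc : (d : nat) <> a.+1 by move=> e; apply: cc; exact: val_inj.
have := tl_ncross D (inl a) (inl c); have := tl_ncross D (inl d) (inl a).
rewrite ab -E tlK E /= => nc1 nc2.
by exists c, d; split=> //=; lia.
Qed.

(** Descent on the width of the cap by [cap_inside]. *)
Lemma ex_adjacent_cap D a b : val D (inl a) = inl b -> a < b ->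
  exists c d, val D (inl c) = inl d /\ d = c.+1 :> nat.
Proof.
have [n] := ubnP (b - a); elim: n a b => // n IH a b abn ab ltab.
have [ba|nab] := eqVneq (b : nat) a.+1; first by exists a, b.
have [c [d [cd ac ltcd db]]] := cap_inside ab ltab (elimN eqP nab).
by apply: IH cd ltcd; lia.
Qed.

Definition flat D :=
  [forall a, forall b, (val D (inl a) == inl b) && (a < b) ==> (b == a.+1 :> nat)].

Lemma flatP D : reflect
  (forall a b, val D (inl a) = inl b -> a < b -> b = a.+1 :> nat) (flat D).
Proof.
apply: (iffP forallP) => [+ a b ab ltab|fD a]; last first.
  by apply/forallP => b; apply/implyP => /andP[/eqP ab ?]; apply/eqP; exact: fD.
by move=> /(_ a)/forallP/(_ b); rewrite ab eqxx ltab => /eqP.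
Qed.

(** By [cap_inside], a cap that does not join neighbours encloses another one. *)
Lemma non_nested_flat D : non_nested D = flat D.
Proof.
apply/idP/flatP => [nD a b ab ltab|fD].
  apply/eqP; apply: contraT => nab.
  have [c [d [cd ac ltcd db]]] := cap_inside ab ltab (elimN eqP nab).
  move/forallP/(_ a)/forallP/(_ b)/forallP/(_ c)/forallP/(_ d): nD.
  by rewrite ab cd !eqxx ac ltcd db.
do 4!apply/forallP => ?; apply/implyP => /andP[/eqP ab /eqP cd].
by apply/negP => /and3P[ac ltcd db]; have := fD _ _ ab; lia.
Qed.

(* caps_from only constrains the caps between neighbours, as a cap that
   encloses another one cannot be removed first. *)
Definition caps_from q D :=
  [forall a, forall b, (val D (inl a) == inl b) && (b == a.+1 :> nat) ==> (q <= a)].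
Definition caps_upto q D :=
  [forall a, forall b, (val D (inl a) == inl b) && (a < b) ==> (a < q)].

Lemma caps_fromP q D : reflect
  (forall a b, val D (inl a) = inl b -> b = a.+1 :> nat -> q <= a) (caps_from q D).
Proof.
apply: (iffP forallP) => [+ a b ab ltab|fD a]; last first.
  by apply/forallP => b; apply/implyP => /andP[/eqP ab /eqP]; exact: fD.
by move=> /(_ a)/forallP/(_ b); rewrite ab ltab !eqxx.
Qed.

Lemma caps_uptoP q D : reflect
  (forall a b, val D (inl a) = inl b -> a < b -> a < q) (caps_upto q D).
Proof.
apply: (iffP forallP) => [+ a b ab ltab|fD a]; last first.
  by apply/forallP => b; apply/implyP => /andP[/eqP ab]; exact: fD.
by move=> /(_ a)/forallP/(_ b); rewrite ab ltab eqxx.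
Qed.

Lemma epiP D : reflect (forall b : 'I_j.*2, exists a, val D (inr b) = inl a) (epi D).
Proof.
by apply: (iffP forallP) => eD b; [case/existsP: (eD b) => a /eqP|
  case: (eD b) => a ab; apply/existsP]; exists a => //; apply/eqP.
Qed.

(** Pigeonhole: without a turn-back, the [i.*2] bottom points would be joined injectively to the
    [j.*2] top points. *)
Lemma epi_ex_cap D : j < i -> exists a b, val D (inl a) = inl b /\ a < b.
Proof.
move=> ji; case: (pickP [pred ab : 'I_i.*2 * 'I_i.*2 |
    val D (inl ab.1) == inl ab.2]) => [[a b] /= /eqP ab|no].
  have [ltab|ltba|eab] := ltngtP a b; first by exists a, b.
    by exists b, a; rewrite -ab tlK.
  by have := tl_neq D (inl a); rewrite ab (val_inj eab) eqxx.
have top a : {b : 'I_j.*2 | val D (inl a) = inr b}.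
  by case E: (val D (inl a)) => [b|b]; [have := no (a, b); rewrite /= E eqxx|exists b].
have top_inj : injective (fun a => sval (top a)).
  move=> a b /= ab; have := svalP (top a); rewrite ab -(svalP (top b)).
  by move/(inv_inj (tlK D)) => -[].
by have := leq_card _ top_inj; rewrite !card_ord leq_double leqNgt ji.
Qed.

End Diagrams.

Section Identity.
Variable i : nat.

Definition tl_id_fun : {ffun tl_point i i -> tl_point i i} :=
  [ffun x : tl_point i i => match x with inl a => inr a | inr b => inl b end].

Lemma tl_id_funE x :
  tl_id_fun x = match x with inl a => inr a | inr b => inl b end.
Proof. by rewrite /tl_id_fun ffunE. Qed.

Lemma tl_id_proof : is_tl tl_id_fun.
Proof.
apply: is_tlP => [[a|a]|[a|a]|x y]; rewrite ?tl_id_funE //.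
have arith (a b : 'I_i.*2) : i.*2 + (i.*2 - a.+1) < i.*2 + (i.*2 - b.+1) -> b < a.
  by have := ltn_ord a; have := ltn_ord b; lia.
by case: x y => [a|a] [b|b] /=; apply/negP => /and3P[];
  have /= := arith a b; have /= := arith b a; have := ltn_ord a; have := ltn_ord b; lia.
Qed.

Definition tl_id : tl_diagram i i := exist _ tl_id_fun tl_id_proof.

Lemma tl_id_epi : epi tl_id.
Proof. by apply/epiP => b; exists b; rewrite /= tl_id_funE. Qed.

Lemma homo_ord_id n (f : 'I_n -> 'I_n) :
  {homo f : a b / a < b} -> forall a, f a = a.
Proof.
move=> fh a; apply: val_inj => /=; apply/eqP; rewrite eqn_leq; apply/andP; split.
  have [t] := ubnP (n - a); elim: t a => // t IH a at_.
  have [an|an] := ltnP a.+1 n; last by have := ltn_ord (f a); lia.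
  pose b : 'I_n := Ordinal an.
  by have /= := IH b; have := fh a b; rewrite /=; lia.
have [t] := ubnP a; elim: t a => // t IH a at_.
have [->|a0] := posnP a; first by [].
have an : a.-1 < n by have := ltn_ord a; lia.
pose b : 'I_n := Ordinal an.
by have /= := IH b; have := fh b a; rewrite /=; lia.
Qed.

(** Planarity forces the bottom ends of the strands from the top to increase from left to right, and
    a strictly increasing self-map of an ordinal is the identity. *)
Lemma epi_id (D : tl_diagram i i) : epi D = (D == tl_id).
Proof.
apply/idP/eqP => [/epiP eD|->]; last exact: tl_id_epi.
pose f b := sval (cid (eD b)).
have fE b : val D (inr b) = inl (f b) by exact: svalP (cid (eD b)).
have f_id : forall b, f b = b.
  apply: homo_ord_id => a b ab.
  have := tl_ncross D (inl (f b)) (inl (f a)); rewrite -!fE !tlK !fE /=.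
  have nab : f a <> f b.
    move=> eab; have : val D (inr a) = val D (inr b) by rewrite !fE eab.
    by move/(inv_inj (tlK D)) => -[] /(congr1 val) /=; lia.
  have : (f a : nat) <> f b by move=> e; apply: nab; exact: val_inj.
  have := ltn_ord a; have := ltn_ord b; have := ltn_ord (f a); lia.
apply: tl_diagram_eq => -[a|a]; rewrite /= tl_id_funE; last by rewrite fE f_id.
by rewrite -[RHS](tlK D) fE f_id.
Qed.

End Identity.

(** * Composition of a diagram with a cap *)

Section Insert.
Variables (i l : nat) (p : 'I_i.*2.+1).

Definition skip2 (a : nat) := if a < p then a else a.+2.

Lemma skip2P a : a < p /\ skip2 a = a \/ p <= a /\ skip2 a = a.+2.
Proof. by rewrite /skip2; case: (ltnP a p); [left|right]. Qed.

Definition skip_ord (a : 'I_i.*2) : 'I_i.+1.*2 := inord (skip2 a).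

Lemma skip_ordE a : skip_ord a = skip2 a :> nat.
Proof.
have h : skip2 a < i.*2.+2.
  by have := skip2P a; have := ltn_ord a; have := ltn_ord p; lia.
exact: inordK h.
Qed.

Definition lift_pt (x : tl_point i l) : tl_point i.+1 l :=
  match x with inl a => inl (skip_ord a) | inr b => inr b end.

Definition cap_l : 'I_i.+1.*2 := inord p.
Definition cap_r : 'I_i.+1.*2 := inord p.+1.

Lemma cap_lE : cap_l = p :> nat.
Proof. by apply: (@inordK i.*2.+1); have := ltn_ord p; lia. Qed.

Lemma cap_rE : cap_r = p.+1 :> nat.
Proof. by apply: (@inordK i.*2.+1); have := ltn_ord p; lia. Qed.

Lemma tl_pos_lift x : tl_pos (lift_pt x) = skip2 (tl_pos x).
Proof.
case: x => [a|b]; first exact: skip_ordE.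
by have := skip2P (i.*2 + (l.*2 - b.+1)); rewrite /tl_pos /lift_pt doubleS /=;
  have := ltn_ord p; lia.
Qed.

Lemma skip2_lt s t : (skip2 s < skip2 t) = (s < t).
Proof.
by have := skip2P s; have := skip2P t; lia.
Qed.

Lemma lift_pt_inj : injective lift_pt.
Proof.
move=> x y /(congr1 (@tl_pos _ _)); rewrite !tl_pos_lift => xy; apply: tl_pos_inj.
by move: xy; have := skip2P (tl_pos x); have := skip2P (tl_pos y); lia.
Qed.

Lemma lift_neq_l x : lift_pt x <> inl cap_l.
Proof.
move=> /(congr1 (@tl_pos _ _)); rewrite tl_pos_lift /= cap_lE.
by have := skip2P (tl_pos x); lia.
Qed.

Lemma lift_neq_r x : lift_pt x <> inl cap_r.
Proof.
move=> /(congr1 (@tl_pos _ _)); rewrite tl_pos_lift /= cap_rE.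
by have := skip2P (tl_pos x); lia.
Qed.

(** Valued in [Type] because the enlarged matching is defined by cases on it. *)
Variant insert_view : tl_point i.+1 l -> Type :=
  | InsertL : insert_view (inl cap_l)
  | InsertR : insert_view (inl cap_r)
  | InsertLift x : insert_view (lift_pt x).

Lemma insertP y : insert_view y.
Proof.
case: y => [a|b]; last exact: (InsertLift (inr b)).
have [/val_inj ->|al] := eqVneq (a : nat) cap_l; first exact: InsertL.
have [/val_inj ->|ar] := eqVneq (a : nat) cap_r; first exact: InsertR.
move: al ar; rewrite cap_lE cap_rE => al ar.
have a'i : (if a < p then a : nat else a.-2) < i.*2.
  by have /= := ltn_ord a; have := ltn_ord p; case: (ltnP a p) => //; lia.
suff -> : a = skip_ord (Ordinal a'i) by exact: (InsertLift (inl (Ordinal a'i))).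
apply: val_inj; rewrite /= skip_ordE /=.
by case: (ltnP a p) => ap; [have := skip2P a|have := skip2P a.-2]; lia.
Qed.

Section Build.
Variable D : tl_diagram i l.

Definition insert_at y (v : insert_view y) : tl_point i.+1 l :=
  match v with
  | InsertL => inl cap_r
  | InsertR => inl cap_l
  | InsertLift x => lift_pt (val D x)
  end.

Definition insert_fun : {ffun tl_point i.+1 l -> tl_point i.+1 l} :=
  [ffun y => insert_at (insertP y)].

Lemma cap_l_neq_r : cap_l <> cap_r.
Proof. by move=> /(congr1 val) /=; rewrite cap_lE cap_rE; lia. Qed.

Lemma insert_fun_l : insert_fun (inl cap_l) = inl cap_r.
Proof.
rewrite /insert_fun ffunE.
(* [insertP] is opaque, so the value is computed for an arbitrary view of the point. *)
have h y (v : insert_view y) : y = inl cap_l -> insert_at v = inl cap_r.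
  by case: v => [//|[/esym/cap_l_neq_r]|x /lift_neq_l].
exact: h.
Qed.

Lemma insert_fun_r : insert_fun (inl cap_r) = inl cap_l.
Proof.
rewrite /insert_fun ffunE.
have h y (v : insert_view y) : y = inl cap_r -> insert_at v = inl cap_l.
  by case: v => [[/cap_l_neq_r]|//|x /lift_neq_r].
exact: h.
Qed.

Lemma insert_fun_lift x : insert_fun (lift_pt x) = lift_pt (val D x).
Proof.
rewrite /insert_fun ffunE.
have h y (v : insert_view y) : y = lift_pt x -> insert_at v = lift_pt (val D x).
  by case: v => [/esym/lift_neq_l|/esym/lift_neq_r|z /lift_pt_inj ->].
exact: h.
Qed.

Definition insert_funE := (insert_fun_l, insert_fun_r, insert_fun_lift).

Lemma insert_proof : is_tl insert_fun.
Proof.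
apply: is_tlP => [y|y|y z].
- by case: (insertP y) => [||x]; rewrite !insert_funE ?tlK.
- case: (insertP y) => [||x]; rewrite !insert_funE; apply/eqP.
  + by case=> /esym/cap_l_neq_r.
  + by case=> /cap_l_neq_r.
  + by move=> /lift_pt_inj/eqP; rewrite (negPf (tl_neq D x)).
- case: (insertP y) => [||x]; case: (insertP z) => [||x']; rewrite !insert_funE /=
    ?cap_lE ?cap_rE; try lia.
  by rewrite !tl_pos_lift !skip2_lt; exact: tl_ncross.
Qed.

(** The composite D C_p; with the identity diagram in place of [D] it is C_p itself. *)
Definition insert_cap : tl_diagram i.+1 l := exist _ insert_fun insert_proof.

Lemma insert_cap_l : val insert_cap (inl cap_l) = inl cap_r.
Proof. exact: insert_fun_l. Qed.
Lemma insert_cap_r : val insert_cap (inl cap_r) = inl cap_l.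
Proof. exact: insert_fun_r. Qed.
Lemma insert_cap_lift x : val insert_cap (lift_pt x) = lift_pt (val D x).
Proof. exact: insert_fun_lift. Qed.

Lemma insert_cap_skip a b : val D (inl a) = inl b ->
  val insert_cap (inl (skip_ord a)) = inl (skip_ord b).
Proof. by move=> ab; rewrite -[inl (skip_ord a)]/(lift_pt (inl a)) insert_cap_lift ab. Qed.

Lemma insert_capP (c d : 'I_i.+1.*2) : val insert_cap (inl c) = inl d ->
  [\/ c = cap_l /\ d = cap_r, c = cap_r /\ d = cap_l |
      exists a b, [/\ val D (inl a) = inl b, c = skip_ord a & d = skip_ord b]].
Proof.
have h (y : tl_point i.+1 l) : insert_view y -> y = inl c -> val insert_cap y = inl d ->
  [\/ c = cap_l /\ d = cap_r, c = cap_r /\ d = cap_l |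
      exists a b, [/\ val D (inl a) = inl b, c = skip_ord a & d = skip_ord b]].
  case=> [[<-]|[<-]|x].
  - by rewrite insert_cap_l => -[<-]; constructor 1.
  - by rewrite insert_cap_r => -[<-]; constructor 2.
  rewrite insert_cap_lift; case: x => [a|//] [<-].
  by case E: (val D _) => [b|//] [<-]; constructor 3; exists a, b.
exact: h (insertP _) erefl.
Qed.

Lemma insert_cap_epi : epi insert_cap = epi D.
Proof.
apply/epiP/epiP => eD b; have := eD b.
  rewrite -[inr b]/(lift_pt (inr b)) insert_cap_lift => -[a].
  by case E: (val D _) => [a'|//] _; exists a'.
by case=> a ab; exists (skip_ord a); rewrite -[inr b]/(lift_pt (inr b)) insert_cap_lift ab.
Qed.

End Build.

Lemma insert_cap_inj : injective insert_cap.
Proof.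
move=> D D' DD'; apply: tl_diagram_eq => x; apply: lift_pt_inj.
by rewrite -!insert_cap_lift DD'.
Qed.

Lemma insert_cap_ex (D2 : tl_diagram i.+1 l) :
  val D2 (inl cap_l) = inl cap_r -> exists D, D2 = insert_cap D.
Proof.
move=> Dlr; have Drl : val D2 (inl cap_r) = inl cap_l by rewrite -Dlr tlK.
have DL x : {y | val D2 (lift_pt x) = lift_pt y}.
  have h y : insert_view y -> y = val D2 (lift_pt x) -> {z | y = lift_pt z}.
    case=> [e|e|z _]; last by exists z.
      by move: (tlK D2 (lift_pt x)); rewrite -e Dlr => /esym/lift_neq_r.
    by move: (tlK D2 (lift_pt x)); rewrite -e Drl => /esym/lift_neq_l.
  exact: h (insertP _) erefl.
pose f := [ffun x => sval (DL x)].
have fE x : lift_pt (f x) = val D2 (lift_pt x) by rewrite ffunE -(svalP (DL x)).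
have fP : is_tl f.
  apply: is_tlP => [x|x|x y].
  - by apply: lift_pt_inj; rewrite !fE tlK.
  - by apply/eqP => /(congr1 lift_pt)/eqP; rewrite fE (negPf (tl_neq _ _)).
  - by have := tl_ncross D2 (lift_pt x) (lift_pt y); rewrite -!fE !tl_pos_lift !skip2_lt.
exists (exist _ f fP : tl_diagram i l); apply: tl_diagram_eq => y.
case: (insertP y) => [||x]; first by rewrite insert_cap_l.
  by rewrite insert_cap_r.
by rewrite insert_cap_lift -fE.
Qed.

(** A cap of [D] from [p.-1] to [p] encloses the new one and no longer joins neighbours, while a cap
    between neighbours further left keeps its place. For [p = 0] the truncated predecessor is
    harmless, as both sides are always true. *)
Lemma caps_from_insert D : caps_from p (insert_cap D) = caps_from p.-1 D.
Proof.
apply/caps_fromP/caps_fromP => pD a b.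
  move=> ab ba; have := pD _ _ (insert_cap_skip ab); rewrite !skip_ordE.
  by have := ltn_ord p; have := skip2P a; have := skip2P b; lia.
case/insert_capP => [[-> ->]|[-> ->]|[a' [b' [ab -> ->]]]].
- by rewrite cap_lE.
- by rewrite cap_lE cap_rE; lia.
have := pD _ _ ab; rewrite !skip_ordE.
by have := skip2P a'; have := skip2P b'; lia.
Qed.

(** A cap of [D] starting at [p.-1] would enclose the new cap, and one starting at [p] or later
    would end up to the right of it. For [p = 0] both sides say that [D] has no caps. *)
Lemma flat_insert D :
  flat (insert_cap D) && caps_upto p.+1 (insert_cap D) = flat D && caps_upto p.-1 D.
Proof.
apply/andP/andP => -[/flatP fD /caps_uptoP uD].
  have h a b : val D (inl a) = inl b -> a < b -> b = a.+1 :> nat /\ a < p.-1.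
    move=> ab ltab; have ab' := insert_cap_skip ab.
    have := fD _ _ ab'; have := uD _ _ ab'; rewrite !skip_ordE.
    by have := skip2P a; have := skip2P b; lia.
  by split; [apply/flatP|apply/caps_uptoP] => a b ab ltab; case: (h _ _ ab ltab).
have h c d : val (insert_cap D) (inl c) = inl d -> c < d -> d = c.+1 :> nat /\ c < p.+1.
  case/insert_capP => [[-> ->]|[-> ->]|[a [b [ab -> ->]]]].
  - by rewrite cap_lE cap_rE; lia.
  - by rewrite cap_lE cap_rE; lia.
  have := fD _ _ ab; have := uD _ _ ab; rewrite !skip_ordE.
  by have := skip2P a; have := skip2P b; lia.
by split; [apply/flatP|apply/caps_uptoP] => a b ab ltab; case: (h _ _ ab ltab).
Qed.

Lemma sum_insert (V : nmodType) (F : tl_diagram i.+1 l -> V)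
    (P : pred (tl_diagram i.+1 l)) (P' : pred (tl_diagram i l)) :
    (forall D, P (insert_cap D) = P' D) ->
  (\sum_(D | P D && (val D (inl cap_l) == inl cap_r)) F D
     = \sum_(D | P' D) F (insert_cap D))%R.
Proof.
move=> PP'; rewrite -(big_imset (h := insert_cap) F (A := [pred D | P' D])) /=; last first.
  by move=> D D' _ _; exact: insert_cap_inj.
apply: eq_bigl => D; apply/andP/imsetP => [[PD /eqP/insert_cap_ex[D' DE]]|[D' PD ->]].
  by exists D' => //; rewrite inE -PP' -DE.
by rewrite PP' insert_cap_l eqxx.
Qed.

End Insert.

(** * Leftmost innermost and rightmost caps *)

Section Extremal.
Variables (i l : nat) (D : tl_diagram i.+1 l).
Local Notation has_cap p := (val D (inl (cap_l p)) == inl (cap_r p)).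

Lemma has_cap_ord (a b : 'I_i.+1.*2) : val D (inl a) = inl b -> b = a.+1 :> nat ->
  exists2 p : 'I_i.*2.+1, has_cap p & p = a :> nat.
Proof.
move=> ab ba; have ai : a < i.*2.+1 by have /= := ltn_ord b; lia.
exists (Ordinal ai) => //; apply/eqP.
have -> : cap_l (Ordinal ai) = a by apply: val_inj; rewrite /= cap_lE.
by rewrite ab; congr inl; apply: val_inj; rewrite /= cap_rE.
Qed.

(** Stated as a characterisation of one [p], so that a diagram contributes to a single term when a
    sum is split by its leftmost cap. *)
Lemma leftmost_cap : l < i.+1 ->
  exists p : 'I_i.*2.+1, forall q : 'I_i.*2.+1, has_cap q && caps_from q D = (q == p).
Proof.
move=> li; have [a [b [ab ltab]]] := epi_ex_cap D li.
have [c [d [cd dc]]] := ex_adjacent_cap ab ltab.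
have [p0 p0c _] := has_cap_ord cd dc.
pose p := [arg min_(q < p0 | has_cap q) (q : nat)].
have [pc pmin] : has_cap p /\ forall q : 'I_i.*2.+1, has_cap q -> p <= q.
  by rewrite /p; case: arg_minnP.
have pf : caps_from p D.
  by apply/caps_fromP => a' b' ab' ba'; have [q /pmin + <-] := has_cap_ord ab' ba'.
exists p => q; apply/andP/eqP => [[qc /caps_fromP qf]|->] //.
apply: val_inj; apply/eqP; rewrite eqn_leq pmin // andbT.
have := qf _ _ (eqP pc); rewrite cap_lE cap_rE; exact.
Qed.

Lemma caps_from_leq (p : 'I_i.*2.+1) q : has_cap p -> caps_from p D ->
  caps_from q D = (q <= p).
Proof.
move=> /eqP pc /caps_fromP pf; apply/caps_fromP/idP => [/(_ _ _ pc)|qp a b ab ba].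
  by rewrite cap_lE cap_rE; exact.
exact: leq_trans qp (pf _ _ ab ba).
Qed.

Lemma rightmost_cap : l < i.+1 -> flat D ->
  exists p : 'I_i.*2.+1, forall q : 'I_i.*2.+1, has_cap q && caps_upto q.+1 D = (q == p).
Proof.
move=> li /flatP fD; have [a [b [ab ltab]]] := epi_ex_cap D li.
have [p0 p0c _] := has_cap_ord ab (fD _ _ ab ltab).
pose p := [arg max_(q > p0 | has_cap q) (q : nat)].
have [pc pmax] : has_cap p /\ forall q : 'I_i.*2.+1, has_cap q -> q <= p.
  by rewrite /p; case: arg_maxnP.
have pu : caps_upto p.+1 D.
  apply/caps_uptoP => a' b' ab' ltab'.
  by have [q /pmax + <-] := has_cap_ord ab' (fD _ _ ab' ltab').
exists p => q; apply/andP/eqP => [[qc /caps_uptoP qu]|->] //.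
apply: val_inj; apply/eqP; rewrite eqn_leq pmax //=.
by have := qu _ _ (eqP pc); rewrite cap_lE cap_rE ltnS; exact.
Qed.

Lemma caps_upto_ltn (p : 'I_i.*2.+1) q : has_cap p -> caps_upto p.+1 D ->
  caps_upto q D = (p < q).
Proof.
move=> /eqP pc /caps_uptoP pu; apply/caps_uptoP/idP => [/(_ _ _ pc)|pq a b ab ba].
  by rewrite cap_lE cap_rE; exact.
exact: leq_trans (pu _ _ ab ba) pq.
Qed.

Lemma epi_no_caps_from : l < i.+1 -> caps_from i.+1.*2 D = false.
Proof.
move=> li; have [p /(_ p)] := leftmost_cap li; rewrite eqxx => /andP[pc pf].
by rewrite (caps_from_leq _ pc pf); have := ltn_ord p; lia.
Qed.

End Extremal.

Section ExtremalSums.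
Variables (i l : nat) (V : nmodType) (F : tl_diagram i.+1 l -> V).
Hypothesis li : l < i.+1.
Local Open Scope ring_scope.

Lemma sum_by_leftmost q :
  \sum_(D | epi D && caps_from q D) F D
  = \sum_(p : 'I_i.*2.+1 | (q <= p)%N)
      \sum_(D : tl_diagram i l | epi D && caps_from p.-1 D) F (insert_cap p D).
Proof.
transitivity (\sum_(p : 'I_i.*2.+1 | (q <= p)%N)
   \sum_(D | (epi D && caps_from p D) && (val D (inl (cap_l p)) == inl (cap_r p))) F D).
  (* After the exchange each diagram occurs once, for [p] its leftmost innermost cap, and
     [caps_from q] amounts to [q <= p]. *)
  rewrite (exchange_big_dep [pred D | epi D && caps_from q D]) /=.
    apply: eq_bigr => D /andP[eD qD]; have [p pP] := leftmost_cap D li.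
    rewrite (big_pred1 p) // => p'; rewrite eD /= [caps_from _ _ && _]andbC pP.
    rewrite /= andbC; case: eqP => //= ->.
    by have := pP p; rewrite eqxx => /andP[pc pf]; rewrite -(caps_from_leq _ pc pf).
  move=> p D qp /andP[/andP[-> pf] pc].
  by rewrite (caps_from_leq _ pc pf).
apply: eq_bigr => p _; apply: sum_insert => D.
by rewrite insert_cap_epi caps_from_insert.
Qed.

Lemma sum_by_rightmost q :
  \sum_(D | [&& epi D, flat D & caps_upto q D]) F D
  = \sum_(p : 'I_i.*2.+1 | (p < q)%N)
      \sum_(D : tl_diagram i l | [&& epi D, flat D & caps_upto p.-1 D]) F (insert_cap p D).
Proof.
transitivity (\sum_(p : 'I_i.*2.+1 | (p < q)%N)
   \sum_(D | [&& epi D, flat D & caps_upto p.+1 D]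
             && (val D (inl (cap_l p)) == inl (cap_r p))) F D).
  rewrite (exchange_big_dep [pred D | [&& epi D, flat D & caps_upto q D]]) /=.
    apply: eq_bigr => D /and3P[eD fD qD]; have [p pP] := rightmost_cap li fD.
    rewrite (big_pred1 p) // => p'; rewrite eD fD /= [caps_upto _ _ && _]andbC pP.
    rewrite /= andbC; case: eqP => //= ->.
    by have := pP p; rewrite eqxx => /andP[pc pu]; rewrite -(caps_upto_ltn _ pc pu).
  move=> p D qp /andP[/and3P[-> -> pu] pc].
  by rewrite (caps_upto_ltn _ pc pu).
apply: eq_bigr => p _; apply: sum_insert => D.
by rewrite insert_cap_epi flat_insert.
Qed.

End ExtremalSums.

(** * Temperley-Lieb tangles *)

Lemma box_joinK i k : cancel (@box_join i k) (@box_split i k).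
Proof. by move=> u; rewrite /box_split /box_join cast_ordKV unsplitK. Qed.

Lemma box_splitK i k : cancel (@box_split i k) (@box_join i k).
Proof. by move=> p; rewrite /box_split /box_join splitK cast_ordK. Qed.

Lemma box_join_inr i k (r : 'I_k.*2) : box_join (i := i) (inr r) = i.*2 + r :> nat.
Proof. by []. Qed.

Section TLPoints.
Variables (k i j : nat).
Local Notation E := {v : option unit & points (tl_col k i j v)}.

Definition tl_side (inner : bool) (r : 'I_k.*2) : E :=
  if inner then tl_inner j (box_join (inr r)) else tl_outer i (box_join (inr r)).

Variant tl_point_view : E -> Type :=
  | TLTop x : tl_point_view (tl_top k x)
  | TLSide v r : tl_point_view (tl_side v r).

Lemma tl_pointP e : tl_point_view e.
Proof.
case: e => -[[]|] p; rewrite -(box_splitK (p : 'I_(_ + k).*2)); case: box_split => [a|r].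
- exact: (TLTop (inl a)).
- exact: (TLSide true r).
- exact: (TLTop (inr a)).
- exact: (TLSide false r).
Qed.

(** The annular order is the order around the rectangle with a block of [k.*2.*2] side points
    inserted between the bottom and the top. *)
Lemma annular_pos_top (x : tl_point i j) :
  annular_pos (tl_top k x) = tl_pos x + (if x is inr _ then k.*2.*2 else 0).
Proof.
case: x => [a|b]; first by rewrite addn0.
by rewrite /annular_pos /= !doubleD; have := ltn_ord b; lia.
Qed.

Lemma annular_pos_side v r :
  annular_pos (tl_side v r) = i.*2 + (if v then r : nat else k.*2.*2.-1 - r).
Proof.
by case: v => //; rewrite /annular_pos /= !doubleD; have := ltn_ord r; lia.
Qed.

Variable D : tl_diagram i j.

Lemma tl_mate_top x : tl_mate D (tl_top k x) = tl_top k (val D x).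
Proof. by case: x => a; rewrite /= box_joinK. Qed.

Lemma tl_mate_side v r : tl_mate D (tl_side v r) = tl_side (~~ v) r.
Proof. by case: v; rewrite /tl_side /= box_joinK. Qed.

Lemma tl_mateK : involutive (@tl_mate k i j D).
Proof.
by move=> e; case: (tl_pointP e) => [x|v r];
  rewrite ?tl_mate_top ?tl_mate_side ?tlK ?negbK.
Qed.

Lemma tl_col_shade v : (tl_col k i j v).2 = false.
Proof. by []. Qed.

(** The side strings are nested arcs, placed symmetrically in the block of side points. They do not
    cross each other, nor the strands of [D], which have no ends inside the block. *)
Lemma tl_mate_ncross (e e' : E) : ~~ [&& annular_pos e < annular_pos e',
  annular_pos e' < annular_pos (tl_mate D e)
  & annular_pos (tl_mate D e) < annular_pos (tl_mate D e')].
Proof.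
have posP (x : tl_point i j) :
    exists2 t, annular_pos (tl_top k x) = t
      & tl_pos x = t /\ t < i.*2 \/ t = tl_pos x + k.*2.*2 /\ i.*2 <= tl_pos x.
  exists (annular_pos (tl_top k x)); rewrite // annular_pos_top; case: x => [a|b] /=.
    by left; have := ltn_ord a; lia.
  by right; lia.
have sideP v (r : 'I_k.*2) : exists2 t, annular_pos (tl_side v r) = i.*2 + t
    & t < k.*2.*2 /\ annular_pos (tl_side (~~ v) r) = i.*2 + (k.*2.*2.-1 - t).
  exists (if v then r : nat else k.*2.*2.-1 - r); rewrite annular_pos_side //.
  by have := ltn_ord r; case: v => /=; lia.
case: (tl_pointP e) => [x|v r]; case: (tl_pointP e') => [y|w s];
  rewrite ?tl_mate_top ?tl_mate_side.
- have := tl_ncross D x y.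
  have [t -> ht] := posP x; have [t' -> ht'] := posP y.
  have [u -> hu] := posP (val D x); have [u' -> hu'] := posP (val D y).
  by move: ht ht' hu hu'; do 4!case=> -[? ?]; lia.
- have [t -> ht] := posP x; have [u -> hu] := posP (val D x).
  have [t' -> [lt' ->]] := sideP w s.
  by move: ht hu; do 2!case=> -[? ?]; lia.
- have [t -> ht] := posP y; have [u -> hu] := posP (val D y).
  have [t' -> [lt' ->]] := sideP v r.
  by move: ht hu; do 2!case=> -[? ?]; lia.
- have [t -> [lt ->]] := sideP v r; have [t' -> [lt' ->]] := sideP w s; lia.
Qed.

Lemma tl_mate_neq (e : E) : tl_mate D e != e.
Proof.
case: (tl_pointP e) => [x|v r]; apply/eqP => /(congr1 (@annular_pos _)).
  rewrite tl_mate_top !annular_pos_top; have := tl_neq D x.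
  move: (val D x) => z; case: z x => [a|a] [b|b] /= neq; last first.
  - move=> pab; case/eqP: neq; congr inr; apply: val_inj => /=; move: pab => /=.
    by have := ltn_ord a; have := ltn_ord b; lia.
  - by have := ltn_ord b; lia.
  - by have := ltn_ord a; lia.
  - by move=> pab; case/eqP: neq; congr inl; apply: val_inj => /=; lia.
by rewrite tl_mate_side !annular_pos_side; have := ltn_ord r; case: v => /=; lia.
Qed.

Lemma tl_planar : epi D -> planar (tl_tangle k D).
Proof.
move=> /epiP eD; apply: annular_planar.
- exact: tl_mateK.
- exact: tl_mate_neq.
- exact: tl_col_shade.
- exact: tl_mate_ncross.
rewrite [npoints _]/= [npoints (tl_col k i j _)]/= !doubleD => jk.
(* Any side string joins the two discs. If there is none, [epi] provides a strand from a top point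
   to the bottom. *)
have [k0|k0] := posnP k.*2.
  have j0 : 0 < j.*2 by lia.
  have [a aE] := eD (Ordinal j0); exists (tl_top k (inl a)).
  have aE' : val D (inl a) = inr (Ordinal j0) by rewrite -aE tlK.
  rewrite tl_mate_top aE' !annular_pos_top /= k0.
  by have := ltn_ord a; lia.
exists (tl_side true (Ordinal k0)).
by rewrite tl_mate_side !annular_pos_side /=; lia.
Qed.

End TLPoints.

(** * Gluing a cap into a tangle *)

Lemma symm_connect_sym (A : finType) (r : rel A) : connect_sym (symm r).
Proof. by apply: sym_connect_sym => x y; rewrite /symm /= orbC. Qed.

Section GlueClasses.
Variables (A B C : finType) (rA : rel A) (rB : rel B) (rC : rel C).
Hypotheses (symA : connect_sym rA) (symB : connect_sym rB) (symC : connect_sym rC).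
Local Notation U := (eq_class rA + eq_class rB)%type.
Variables (gl : rel U) (h : A + B -> C) (s : C -> A + B).

Definition sum_class (x : A + B) : U :=
  match x with inl a => inl (to_class rA a) | inr b => inr (to_class rB b) end.
Definition sum_repr (u : U) : A + B :=
  match u with inl a => inl (class_repr a) | inr b => inr (class_repr b) end.

Lemma sum_reprK u : sum_class (sum_repr u) = u.
Proof. by case: u => a /=; rewrite class_reprK. Qed.

Hypothesis hA : forall a a', rA a a' -> connect rC (h (inl a)) (h (inl a')).
Hypothesis hB : forall b b', rB b b' -> connect rC (h (inr b)) (h (inr b')).
Hypothesis h_gl : forall u u', gl u u' ->
  exists x x', [/\ u = sum_class x, u' = sum_class x' & h x = h x'].
Hypothesis s_conn : forall c c', rC c c' ->
  connect (symm gl) (sum_class (s c)) (sum_class (s c')).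
Hypothesis sh : forall x, connect (symm gl) (sum_class (s (h x))) (sum_class x).
Hypothesis hs : forall c, h (s c) = c.

(** The map identifies the quotient by [gl] with the classes of [rC], [s] being a section of [h]. It
    serves twice: for strands, as classes of end points, and for regions, as classes of
    intervals. *)
Definition glue_map (u : U) : eq_class rC := to_class rC (h (sum_repr u)).

Lemma glue_map_class x : glue_map (sum_class x) = to_class rC (h x).
Proof.
apply/(to_classP symC); have := sum_reprK (sum_class x).
case: x (sum_repr _) => [a|b] [a'|b'] //=.
  move=> /(congr1 (fun u : U => if u is inl z then z else to_class rA a)) /(to_classP symA).
  exact: (connect_map (h := fun a => h (inl a))).
move=> /(congr1 (fun u : U => if u is inr z then z else to_class rB b)) /(to_classP symB).
exact: (connect_map (h := fun b => h (inr b))).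
Qed.

Lemma glue_map_surj X : exists u, glue_map u = X.
Proof.
have [c <-] := to_class_surj X; exists (sum_class (s c)).
by rewrite glue_map_class hs.
Qed.

Lemma glue_map_ker u u' : glue_map u = glue_map u' <-> connect (symm gl) u u'.
Proof.
rewrite -(sum_reprK u) -(sum_reprK u'); move: (sum_repr u) (sum_repr u') => x x'.
split=> [|/connectP[t + E]].
  rewrite !glue_map_class => /(to_classP symC) xx'.
  apply: (@connect_trans _ _ (sum_class (s (h x)))).
    by rewrite symm_connect_sym sh.
  apply: connect_trans (sh x').
  exact: (connect_map (h := fun c => sum_class (s c))) xx'.
rewrite E; elim: t (sum_class x) {E} => //= v t IH w /andP[wv /IH <-].
have gE z z' : gl z z' -> glue_map z = glue_map z'.
  by case/h_gl=> y [y' [-> -> yy']]; rewrite !glue_map_class yy'.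
by case/orP: wv => /gE.
Qed.

End GlueClasses.

(** * Points and intervals next to the inserted cap *)

Section CapLink.
Variables (k i l : nat) (p : 'I_i.*2.+1) (D : tl_diagram i.+1 l).
Hypothesis D_cap : val D (inl (cap_l p)) = inl (cap_r p).
Local Notation col := (tl_col k i.+1 l).
Local Notation Ival q := (Tagged (fun v => intervals (col v)) q).
Local Notation link := (arc_link (@tl_mate k i.+1 l D)).
Local Notation N := (i + k).*2.

Definition box_skip (q : 'I_N) : 'I_(i.+1 + k).*2 := inord (skip2 p q).

Lemma box_skipE q : box_skip q = skip2 p q :> nat.
Proof.
apply: (@inordK N.+1); have := skip2P p q; have := ltn_ord q; lia.
Qed.

(** Interval [p] of the smaller box is met on both sides of the cap, before [cap_l] and after
    [cap_r]. The first is chosen here; [cap_link] puts both in one region. *)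
Definition gap_skip (q : 'I_N.-1.+1) : 'I_(i.+1 + k).*2.-1.+1 :=
  inord (if q <= p then q : nat else q.+2).

Lemma gap_skipE q : gap_skip q = (if q <= p then q : nat else q.+2) :> nat.
Proof.
apply: (@inordK N.+1); have := ltn_ord q; have := ltn_ord p.
by case: (leqP q p); lia.
Qed.

Let c_l : points (col (Some tt)) := box_join (inl (cap_l p)).
Let c_r : points (col (Some tt)) := box_join (inl (cap_r p)).

Lemma cap_link : connect link (Ival (before c_l)) (Ival (after c_r)).
Proof.
have sh := @tl_col_shade k i.+1 l.
apply: (touch_link (e := Tagged (fun v => points (col v)) c_l)).
- exact: (touch_before (Tagged (fun v => points (col v)) c_l)).
- have -> : tl_mate D (Tagged (fun v => points (col v)) c_l)
            = Tagged (fun v => points (col v)) c_r.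
    by apply: (etrans (tl_mate_top k D (inl (cap_l p)))); rewrite D_cap.
  exact: (touch_after (Tagged (fun v => points (col v)) c_r)).
rewrite (shade_before sh (Tagged (fun v => points (col v)) c_l)).
rewrite (shade_after sh (Tagged (fun v => points (col v)) c_r)).
by rewrite /= cap_lE cap_rE /= negbK.
Qed.

Let sym := link_sym (@tl_mateK k i.+1 l D).

Lemma gap_skip_before (q : 'I_N) :
  connect link (Ival (gap_skip (@before (i + k, false) q) : intervals (col (Some tt))))
    (Ival (before (box_skip q : points (col (Some tt))))).
Proof.
have gE : gap_skip (@before (i + k, false) q) = (if q <= p then q : nat else q.+2) :> nat.
  by rewrite gap_skipE (@before_val (i + k, false) q).
have bE : @before (col (Some tt)) (box_skip q) = skip2 p q :> nat.
  by apply: etrans (@before_val (col (Some tt)) (box_skip q)) _; exact: box_skipE.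
have qN := ltn_ord q; have sq := skip2P p q.
have [qp|qp] := eqVneq (q : nat) p; last first.
  apply: eq_connect0; congr existT; apply: val_inj.
  by apply: (etrans gE); apply: (etrans _ (esym bE)); case: (leqP q p); lia.
(* For [q = p] the two renumberings disagree: they give the intervals on the two sides of the
   cap. *)
have cl := cap_link; apply: etrans cl; congr (connect _ _ _); congr existT; apply: val_inj.
  apply: (etrans gE); apply: (etrans _ (esym (@before_val (col (Some tt)) c_l))).
  by rewrite qp leqnn /= cap_lE.
apply: (etrans bE); apply: (etrans _ (esym (@after_val (col (Some tt)) c_r))).
rewrite /= cap_rE; have [e|_] := eqVneq p.+2 (i.+1 + k).*2; last by lia.
by exfalso; move: e; rewrite addSn doubleS => -[]; lia.
Qed.

Lemma gap_skip_after (q : 'I_N) :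
  connect link (Ival (gap_skip (@after (i + k, false) q) : intervals (col (Some tt))))
    (Ival (after (box_skip q : points (col (Some tt))))).
Proof.
pose a := if q.+1 == N then 0 else q.+1.
have gE : gap_skip (@after (i + k, false) q) = (if a <= p then a else a.+2) :> nat.
  by rewrite gap_skipE (@after_val (i + k, false) q).
have bE : @after (col (Some tt)) (box_skip q)
    = (if (skip2 p q).+1 == N.+2 then 0 else (skip2 p q).+1) :> nat.
  by apply: etrans (@after_val (col (Some tt)) (box_skip q)) _; rewrite /= box_skipE.
have qN := ltn_ord q; have sq := skip2P p q.
have NE : (i.+1 + k).*2 = N.+2 by [].
rewrite /a in gE.
(* The exceptional case is a cap at the last two points of the box: the interval after [q] wraps
   around to 0, while the one after [box_skip q] is the interval before the cap. *)
have [qp|qp] := boolP ((q < p) && (q.+1 == N)); last first.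
  apply: eq_connect0; congr existT; apply: val_inj.
  apply: (etrans gE); apply: (etrans _ (esym bE)); rewrite !eqSS.
  have [e|e] := eqVneq q.+1 N.
    rewrite leq0n; have -> : skip2 p q = q.+2 by lia.
    by rewrite eqSS e eqxx.
  have [e'|e'] := eqVneq (skip2 p q) N.+1; first by lia.
  by case: (leqP q.+1 p); lia.
rewrite sym; have cl := cap_link; apply: etrans cl.
have pN := ltn_ord p; case/andP: qp => qp /eqP qE.
have pE : p = N :> nat by lia.
congr (connect _ _ _); congr existT; apply: val_inj.
  apply: (etrans bE); apply: (etrans _ (esym (@before_val (col (Some tt)) c_l))).
  by rewrite /= cap_lE; have [e|_] := eqVneq (skip2 p q).+1 N.+2; lia.
apply: (etrans gE); apply: (etrans _ (esym (@after_val (col (Some tt)) c_r))).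
by rewrite qE eqxx /= cap_rE NE pE eqxx.
Qed.

Lemma gap_skip0 : gap_skip ord0 = ord0.
Proof. by apply: val_inj; rewrite /= gap_skipE. Qed.

Lemma odd_gap_skip q : odd (gap_skip q) = odd q.
Proof. by rewrite gap_skipE; case: ifP => //=; rewrite negbK. Qed.

End CapLink.

(** * The composite with a cap as a glued tangle *)

Section InsertGlue.
Variables (k i l : nat) (p : 'I_i.*2.+1) (D : tl_diagram i l).
Let DS := insert_cap p (tl_id i).
Let DR := insert_cap p D.
Local Notation T := (tl_tangle k D).
Local Notation S := (tl_tangle k DS).
Local Notation R := (tl_tangle k DR).
Local Notation colT := (tl_col k i l).
Local Notation colS := (tl_col k i.+1 i).
Local Notation colR := (tl_col k i.+1 l).
Local Notation points_of c := {v : option unit & points (c v)}.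
Local Notation gaps_of c := {v : option unit & intervals (c v)}.
Local Notation Pt c v q := (existT (fun w => points (c w)) v q).
Local Notation Gap c v q := (existT (fun w => intervals (c w)) v q).
Local Notation mT := (@tl_mate k i l D).
Local Notation mS := (@tl_mate k i.+1 i DS).
Local Notation mR := (@tl_mate k i.+1 l DR).

Let mTK : involutive mT := @tl_mateK k i l D.
Let mSK : involutive mS := @tl_mateK k i.+1 i DS.
Let mRK : involutive mR := @tl_mateK k i.+1 l DR.
Let shT : forall v, (colT v).2 = false := @tl_col_shade k i l.
Let shS : forall v, (colS v).2 = false := @tl_col_shade k i.+1 i.
Let shR : forall v, (colR v).2 = false := @tl_col_shade k i.+1 l.

(** Points of the glued circle are moved along the strands of the cap diagram to the inner disc of
    the composite. *)
Definition glue_ptT (e : points_of colT) : points_of colR :=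
  (if tag e is Some _ as v return points (colT v) -> points_of colR
   then fun q => Pt colR (Some tt) (box_skip p q) else fun q => Pt colR None q) (tagged e).
Definition glue_ptS (e : points_of colS) : points_of colR :=
  (if tag e is Some _ as v return points (colS v) -> points_of colR
   then fun q => Pt colR (Some tt) q else fun q => Pt colR (Some tt) (box_skip p q)) (tagged e).
Definition glue_pt (x : points_of colT + points_of colS) : points_of colR :=
  match x with inl e => glue_ptT e | inr e => glue_ptS e end.
Definition unglue_pt (e : points_of colR) : (points_of colT + points_of colS)%type :=
  (if tag e is Some _ as v return points (colR v) -> (points_of colT + points_of colS)%type
   then fun q => inr (Pt colS (Some tt) q) else fun q => inl (Pt colT None q)) (tagged e).

Definition glue_gapT (e : gaps_of colT) : gaps_of colR :=
  (if tag e is Some _ as v return intervals (colT v) -> gaps_of colR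
   then fun q => Gap colR (Some tt) (gap_skip p q) else fun q => Gap colR None q) (tagged e).
Definition glue_gapS (e : gaps_of colS) : gaps_of colR :=
  (if tag e is Some _ as v return intervals (colS v) -> gaps_of colR
   then fun q => Gap colR (Some tt) q else fun q => Gap colR (Some tt) (gap_skip p q)) (tagged e).
Definition glue_gap (x : gaps_of colT + gaps_of colS) : gaps_of colR :=
  match x with inl e => glue_gapT e | inr e => glue_gapS e end.
Definition unglue_gap (e : gaps_of colR) : (gaps_of colT + gaps_of colS)%type :=
  (if tag e is Some _ as v return intervals (colR v) -> (gaps_of colT + gaps_of colS)%type
   then fun q => inr (Gap colS (Some tt) q) else fun q => inl (Gap colT None q)) (tagged e).

Lemma box_skip_join_inl (a : 'I_i.*2) :
  box_skip p (box_join (k := k) (inl a)) = box_join (inl (skip_ord p a)).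
Proof. by apply: val_inj; rewrite /= box_skipE skip_ordE. Qed.

Lemma box_skip_join_inr (r : 'I_k.*2) :
  box_skip p (box_join (i := i) (inr r)) = box_join (inr r).
Proof.
apply: val_inj; rewrite [LHS]box_skipE box_join_inr [RHS](@box_join_inr i.+1 k) doubleS.
by have := skip2P p (i.*2 + r); have := ltn_ord p; lia.
Qed.

Lemma glue_ptT_top x : glue_pt (inl (tl_top k x)) = tl_top k (lift_pt p x).
Proof. by case: x => a //; congr existT; exact: box_skip_join_inl. Qed.

Lemma glue_ptT_side v r : glue_pt (inl (tl_side i l v r)) = tl_side i.+1 l v r.
Proof. by case: v => //; congr existT; exact: box_skip_join_inr. Qed.

Lemma glue_ptS_top (y : tl_point i.+1 i) : glue_pt (inr (tl_top k y)) =
  tl_top k (inl (match y with inl a => a | inr b => skip_ord p b end)).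
Proof. by case: y => a //; congr existT; exact: box_skip_join_inl. Qed.

Lemma glue_ptS_side v r : glue_pt (inr (tl_side i.+1 i v r)) = tl_side i.+1 l true r.
Proof. by case: v => //; congr existT; exact: box_skip_join_inr. Qed.

Lemma glue_pt_mateT e : glue_pt (inl (mT e)) = mR (glue_pt (inl e)).
Proof.
case: (tl_pointP e) => [x|v r].
  by rewrite tl_mate_top !glue_ptT_top tl_mate_top insert_cap_lift.
by rewrite tl_mate_side !glue_ptT_side tl_mate_side.
Qed.

Lemma cap_id_bottom a : val DS (inl (skip_ord p a)) = inr a.
Proof.
rewrite -[inl (skip_ord p a)]/(lift_pt p (inl a : tl_point i i)) insert_cap_lift.
by rewrite /= tl_id_funE.
Qed.

Lemma cap_id_top a : val DS (inr a) = inl (skip_ord p a).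
Proof. by rewrite -cap_id_bottom tlK. Qed.

(** A strand of the cap diagram between its two discs shrinks to a point, and its cap remains a
    cap. *)
Lemma glue_pt_mateS e : glue_pt (inr (mS e)) = glue_pt (inr e) \/
  glue_pt (inr (mS e)) = mR (glue_pt (inr e)).
Proof.
case: (tl_pointP e) => [x|v r]; last first.
  by left; rewrite tl_mate_side !glue_ptS_side.
rewrite tl_mate_top !glue_ptS_top tl_mate_top.
case: (insertP p x) => [||[a|b]].
- by right; rewrite !insert_cap_l.
- by right; rewrite !insert_cap_r.
- by left; rewrite /= cap_id_bottom.
- by left; rewrite [lift_pt p _]/= cap_id_top.
Qed.

Lemma unglue_ptK c : glue_pt (unglue_pt c) = c.
Proof. by case: c => -[[]|] q. Qed.

Lemma unglue_gapK c : glue_gap (unglue_gap c) = c.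
Proof. by case: c => -[[]|] q. Qed.

Local Notation clsP := (sum_class (frel mT) (frel mS)).
Local Notation clsG := (sum_class (arc_link mT) (arc_link mS)).
Local Notation glP := (@strand_glue T S tt).
Local Notation glG := (@region_glue T S tt).

Lemma strand_glue_mid (q : 'I_(i + k).*2) :
  glP (clsP (inl (Pt colT (Some tt) q))) (clsP (inr (Pt colS None q))).
Proof. by apply/existsP; exists q; apply/existsP; exists q; rewrite !eqxx. Qed.

Lemma region_glue_mid (q : 'I_(i + k).*2.-1.+1) :
  glG (clsG (inl (Gap colT (Some tt) q))) (clsG (inr (Gap colS None q))).
Proof. by apply/existsP; exists q; apply/existsP; exists q; rewrite !eqxx. Qed.

Lemma strand_glueP u u' : glP u u' ->
  exists q, u = clsP (inl (Pt colT (Some tt) q)) /\ u' = clsP (inr (Pt colS None q)).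
Proof.
case/existsP=> q /existsP[q' /and3P[/eqP qq' /eqP -> /eqP ->]].
by exists q; rewrite (val_inj qq' : q = q').
Qed.

Lemma region_glueP u u' : glG u u' ->
  exists q, u = clsG (inl (Gap colT (Some tt) q)) /\ u' = clsG (inr (Gap colS None q)).
Proof.
case/existsP=> q /existsP[q' /and3P[/eqP qq' /eqP -> /eqP ->]].
by exists q; rewrite (val_inj qq' : q = q').
Qed.

Lemma symm_connect (A : finType) (r : rel A) x y : r x y -> connect (symm r) x y.
Proof. by move=> xy; apply: connect1; rewrite /symm /= xy. Qed.

Lemma clsP_mateS e : clsP (inr (mS e)) = clsP (inr e).
Proof.
congr inr; apply/(to_classP (frel_sym mSK)); rewrite (frel_sym mSK).
exact: fconnect1.
Qed.

Lemma clsP_mateT e : clsP (inl (mT e)) = clsP (inl e).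
Proof.
congr inl; apply/(to_classP (frel_sym mTK)); rewrite (frel_sym mTK).
exact: fconnect1.
Qed.

Lemma mateS_outer (q : 'I_(i + k).*2) :
  mS (Pt colS None q) = Pt colS (Some tt) (box_skip p q).
Proof.
rewrite -[q](box_splitK (i := i)); case: (box_split q) => [a|r].
  apply: (etrans (tl_mate_top k DS (inr a))); rewrite cap_id_top.
  by rewrite box_skip_join_inl.
apply: (etrans (tl_mate_side DS false r)).
by rewrite box_skip_join_inr.
Qed.

Lemma unglue_glue_pt x : connect (symm glP) (clsP (unglue_pt (glue_pt x))) (clsP x).
Proof.
have mid (q : 'I_(i + k).*2) :
    clsP (inr (Pt colS (Some tt) (box_skip p q))) = clsP (inr (Pt colS None q)).
  by rewrite -mateS_outer clsP_mateS.
case: x => [] [[[]|] q]; rewrite /=; try exact: connect0.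
  rewrite [inr _](mid q) symm_connect_sym; exact: symm_connect (strand_glue_mid q).
by rewrite [inr _](mid q) connect0.
Qed.

Lemma unglue_pt_mate c :
  connect (symm glP) (clsP (unglue_pt c)) (clsP (unglue_pt (mR c))).
Proof.
have hT e : connect (symm glP) (clsP (unglue_pt (glue_pt (inl e))))
    (clsP (unglue_pt (mR (glue_pt (inl e))))).
  rewrite -glue_pt_mateT; apply: connect_trans (unglue_glue_pt _) _.
  by rewrite symm_connect_sym -clsP_mateT; exact: unglue_glue_pt.
have cap : clsP (unglue_pt (tl_top k (inl (cap_l p))))
    = clsP (unglue_pt (tl_top k (inl (cap_r p)))).
  apply: (etrans (esym (clsP_mateS _))); congr clsP; congr inr.
  by apply: (etrans (tl_mate_top k DS (inl (cap_l p)))); rewrite insert_cap_l.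
case: (tl_pointP c) => [y|v r]; last by rewrite -glue_ptT_side.
case: (insertP p y) => [||x]; last by rewrite -glue_ptT_top.
  by rewrite tl_mate_top insert_cap_l cap connect0.
by rewrite tl_mate_top insert_cap_r cap connect0.
Qed.

Lemma glue_gapT_star v : glue_gap (inl (arc_star colT v)) = arc_star colR v.
Proof. by case: v => [[]|] //; congr existT; exact: gap_skip0. Qed.

Lemma glue_gapS_star v : glue_gap (inr (arc_star colS v)) = arc_star colR (Some tt).
Proof. by case: v => [[]|] //; congr existT; exact: gap_skip0. Qed.

Lemma glue_gapT_shade g : arc_shade (glue_gap (inl g)) = arc_shade g.
Proof. by case: g => -[[]|] q; rewrite /arc_shade //=; exact: odd_gap_skip. Qed.

Lemma glue_gapS_shade g : arc_shade (glue_gap (inr g)) = arc_shade g.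
Proof. by case: g => -[[]|] q; rewrite /arc_shade //=; exact: odd_gap_skip. Qed.

Local Notation linkR := (arc_link mR).

Lemma mid_touch (q : 'I_(i + k).*2) (g : 'I_(i + k).*2.-1.+1) :
    g = @before (i + k, false) q \/ g = @after (i + k, false) q ->
  exists2 g', arc_touch (Pt colR (Some tt) (box_skip p q)) g'
            & connect linkR (Gap colR (Some tt) (gap_skip p g)) g'.
Proof.
have cap : val DR (inl (cap_l p)) = inl (cap_r p) by rewrite insert_cap_l.
case=> ->.
  exists (Gap colR (Some tt) (@before (colR (Some tt)) (box_skip p q))).
    exact: (touch_before (Pt colR (Some tt) (box_skip p q))).
  exact: gap_skip_before cap q.
exists (Gap colR (Some tt) (@after (colR (Some tt)) (box_skip p q))).
  exact: (touch_after (Pt colR (Some tt) (box_skip p q))).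
exact: gap_skip_after cap q.
Qed.

Lemma glue_touchT e g : arc_touch e g ->
  exists2 g', arc_touch (glue_pt (inl e)) g' & connect linkR (glue_gap (inl g)) g'.
Proof.
case: e => -[[]|] q.
  by case/orP=> /eqP ->; apply: mid_touch; [left|right].
by case/orP=> /eqP ->; [exists (Gap colR None (@before (colR None) q))
  | exists (Gap colR None (@after (colR None) q))]; try exact: connect0;
  [exact: (touch_before (Pt colR None q)) | exact: (touch_after (Pt colR None q))].
Qed.

Lemma glue_touchS e g : arc_touch e g ->
  exists2 g', arc_touch (glue_pt (inr e)) g' & connect linkR (glue_gap (inr g)) g'.
Proof.
case: e => -[[]|] q; last first.
  by case/orP=> /eqP ->; apply: mid_touch; [left|right].
by case/orP=> /eqP ->; [exists (Gap colR (Some tt) (@before (colR (Some tt)) q))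
  | exists (Gap colR (Some tt) (@after (colR (Some tt)) q))]; try exact: connect0;
  [exact: (touch_before (Pt colR (Some tt) q)) | exact: (touch_after (Pt colR (Some tt) q))].
Qed.

Let linkR_sym : connect_sym linkR := link_sym mRK.

Lemma glue_gap_linkT g g' : arc_link mT g g' ->
  connect linkR (glue_gap (inl g)) (glue_gap (inl g')).
Proof.
move: g g'; apply: link_ind => [e g g' /glue_touchT[h eh gh] /glue_touchT[h' eh' gh'] gg'|v w].
  apply: (connect_trans gh); rewrite linkR_sym; apply: (connect_trans gh').
  rewrite linkR_sym; apply: (touch_link eh); first by rewrite -glue_pt_mateT.
  by rewrite -(connect_shade shR gh) -(connect_shade shR gh') !glue_gapT_shade.
by rewrite !glue_gapT_star; exact: star_link.
Qed.

Lemma glue_gap_linkS g g' : arc_link mS g g' ->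
  connect linkR (glue_gap (inr g)) (glue_gap (inr g')).
Proof.
move: g g'; apply: link_ind => [e g g' /glue_touchS[h eh gh] /glue_touchS[h' eh' gh'] gg'|v w].
  apply: (connect_trans gh); rewrite linkR_sym; apply: (connect_trans gh').
  have hh' : arc_shade h = arc_shade h'.
    by rewrite -(connect_shade shR gh) -(connect_shade shR gh') !glue_gapS_shade.
  case: (glue_pt_mateS e) => eE; rewrite eE in eh'.
    by rewrite (touch_inj shR eh eh' hh') connect0.
  by rewrite linkR_sym; exact: (touch_link eh eh' hh').
by rewrite !glue_gapS_star connect0.
Qed.

(** The strand at point [q] of the glued circle carries the interval before it to the inner disc,
    and [gap_skip_before] corrects for the cap. *)
Lemma gap_midS (q : 'I_(i + k).*2.-1.+1) :
  clsG (inr (Gap colS (Some tt) (gap_skip p q))) = clsG (inr (Gap colS None q)).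
Proof.
congr inr; apply/(to_classP (link_sym mSK)).
(* An interval that precedes no point exists only on a circle without points, where it is the
   distinguished one. *)
have [q0|q0] := ltnP q (i + k).*2; last first.
  have -> : q = ord0 by apply: val_inj => /=; have := ltn_ord q; lia.
  by rewrite gap_skip0; exact: (star_link _ (Some tt) None).
pose pq : 'I_(i + k).*2 := Ordinal q0.
have qE : q = @before (i + k, false) pq by apply: val_inj; rewrite [RHS]before_val.
have cap : val DS (inl (cap_l p)) = inl (cap_r p) by rewrite insert_cap_l.
rewrite {1}qE; apply: connect_trans (gap_skip_before cap pq) _.
rewrite (link_sym mSK).
have qE' : Gap colS None q = Gap colS None (@before (colS None) pq) by rewrite {1}qE.
rewrite qE'; apply: (touch_link (touch_before (Pt colS None pq))).
  rewrite mateS_outer; exact: (touch_before (Pt colS (Some tt) (box_skip p pq))).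
rewrite (shade_before shS (Pt colS None pq)).
rewrite (shade_before shS (Pt colS (Some tt) (box_skip p pq))).
rewrite /= box_skipE; case: (skip2P p q) => -[_ /= ->] //=.
by rewrite negbK.
Qed.

Lemma unglue_glue_gap x : connect (symm glG) (clsG (unglue_gap (glue_gap x))) (clsG x).
Proof.
case: x => [] [[[]|] q]; try exact: connect0.
  apply: (@connect_trans _ _ (clsG (inr (Gap colS None q)))).
    by apply: eq_connect0; exact: gap_midS.
  rewrite symm_connect_sym; exact: symm_connect (region_glue_mid q).
by apply: eq_connect0; exact: gap_midS.
Qed.

(** Describing the region of an interval through a strand it touches reduces links of intervals to
    the gluing of strands. *)
Lemma unglue_side c g b : arc_touch c g -> arc_shade g = b ->
  clsG (unglue_gap g) = sum_side (T := T) (S := S) (clsP (unglue_pt c)) b.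
Proof.
case: c => -[[]|] q cg gb.
  have [h gE hq] : exists2 h, g = Gap colR (Some tt) h
      & arc_touch (Pt colS (Some tt) q) (Gap colS (Some tt) h).
    case/orP: cg => /eqP ->.
      by exists (@before (colR (Some tt)) q) => //; exact: (touch_before (Pt colS (Some tt) q)).
    by exists (@after (colR (Some tt)) q) => //; exact: (touch_after (Pt colS (Some tt) q)).
  rewrite gE; apply: (congr1 inr); apply: esym; apply: (arc_sideE mSK shS hq).
  by rewrite -gb gE.
have [h gE hq] : exists2 h, g = Gap colR None h
    & arc_touch (Pt colT None q) (Gap colT None h).
  case/orP: cg => /eqP ->.
    by exists (@before (colR None) q) => //; exact: (touch_before (Pt colT None q)).
  by exists (@after (colR None) q) => //; exact: (touch_after (Pt colT None q)).
rewrite gE; apply: (congr1 inl); apply: esym; apply: (arc_sideE mTK shT hq).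
by rewrite -gb gE.
Qed.

(** Where strands are glued at a point of the circle, the intervals before and after that point are
    glued too, one on each side. *)
Lemma strand_glue_side u u' b : connect (symm glP) u u' ->
  connect (symm glG) (sum_side (T := T) (S := S) u b) (sum_side (T := T) (S := S) u' b).
Proof.
apply: (connect_map (h := fun u => sum_side (T := T) (S := S) u b)) => {}u {}u'.
have gl v v' : glP v v' ->
    connect (symm glG) (sum_side (T := T) (S := S) v b) (sum_side (T := T) (S := S) v' b).
  case/strand_glueP=> q [-> ->].
  have [<-|nb] := eqVneq (odd q) b.
    rewrite [sum_side _ _](congr1 inl (arc_planar_before mTK shT (q : points (colT (Some tt))))).
    rewrite [X in connect _ _ X](congr1 inr (arc_planar_before mSK shS (q : points (colS None)))).
    exact: symm_connect (region_glue_mid _).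
  have -> : b = ~~ odd q by move: nb; case: odd; case: (b).
  rewrite [sum_side _ _](congr1 inl (arc_planar_after mTK shT (q : points (colT (Some tt))))).
  rewrite [X in connect _ _ X](congr1 inr (arc_planar_after mSK shS (q : points (colS None)))).
  exact: symm_connect (region_glue_mid _).
by case/orP=> /gl //; rewrite symm_connect_sym.
Qed.

Lemma unglue_gap_link g g' : arc_link mR g g' ->
  connect (symm glG) (clsG (unglue_gap g)) (clsG (unglue_gap g')).
Proof.
move: g g'; apply: link_ind => [c g g' cg cg' gg'|v w].
  rewrite (unglue_side cg gg') (unglue_side cg' erefl).
  by apply: strand_glue_side; exact: unglue_pt_mate.
have st v' : connect (symm glG) (clsG (unglue_gap (arc_star colR v')))
    (clsG (inr (arc_star colS None))).
  case: v' => [[]|].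
    apply: eq_connect0; congr inr; apply/(to_classP (link_sym mSK)).
    exact: (star_link _ (Some tt) None).
  apply: (@connect_trans _ _ (clsG (inl (arc_star colT (Some tt))))).
    apply: eq_connect0; congr inl; apply/(to_classP (link_sym mTK)).
    exact: (star_link _ None (Some tt)).
  exact: symm_connect (region_glue_mid ord0).
by apply: connect_trans (st v) _; rewrite symm_connect_sym.
Qed.

Definition insert_strand : strand T + strand S -> strand R :=
  glue_map (frel mR) glue_pt.
Definition insert_region : region T + region S -> region R :=
  glue_map linkR glue_gap.
Definition insert_disc (v : option (disc R)) : option (disc T) + option (disc S) :=
  if v is Some d then inr (Some d) else inl None.

Lemma strand_hyps :
  [/\ forall x, insert_strand (clsP x) = to_class (frel mR) (glue_pt x),
      forall X, exists u, insert_strand u = X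
    & forall u u', insert_strand u = insert_strand u' <-> connect (symm glP) u u'].
Proof.
have hA e e' : frel mT e e' -> connect (frel mR) (glue_pt (inl e)) (glue_pt (inl e')).
  by move=> /eqP <-; rewrite glue_pt_mateT fconnect1.
have hB e e' : frel mS e e' -> connect (frel mR) (glue_pt (inr e)) (glue_pt (inr e')).
  by move=> /eqP <-; case: (glue_pt_mateS e) => ->; rewrite ?connect0 ?fconnect1.
have hgl u u' : glP u u' ->
    exists x x', [/\ u = clsP x, u' = clsP x' & glue_pt x = glue_pt x'].
  case/strand_glueP=> q [-> ->].
  by exists (inl (Pt colT (Some tt) q)), (inr (Pt colS None q)).
have hs c c' : frel mR c c' -> connect (symm glP) (clsP (unglue_pt c)) (clsP (unglue_pt c')).
  by move=> /eqP <-; exact: unglue_pt_mate.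
have symT := frel_sym mTK; have symS := frel_sym mSK; have symR := frel_sym mRK.
split; first exact: glue_map_class.
  exact: (glue_map_surj symT symS symR hA hB unglue_ptK).
exact: (glue_map_ker symT symS symR hA hB hgl hs unglue_glue_pt).
Qed.

Lemma region_hyps :
  [/\ forall x, insert_region (clsG x) = to_class linkR (glue_gap x),
      forall X, exists u, insert_region u = X
    & forall u u', insert_region u = insert_region u' <-> connect (symm glG) u u'].
Proof.
have hgl u u' : glG u u' ->
    exists x x', [/\ u = clsG x, u' = clsG x' & glue_gap x = glue_gap x'].
  case/region_glueP=> q [-> ->].
  by exists (inl (Gap colT (Some tt) q)), (inr (Gap colS None q)).
have symT := link_sym mTK; have symS := link_sym mSK.
split; first exact: (glue_map_class symT symS linkR_sym glue_gap_linkT glue_gap_linkS).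
  exact: (glue_map_surj symT symS linkR_sym glue_gap_linkT glue_gap_linkS unglue_gapK).
exact: (glue_map_ker symT symS linkR_sym glue_gap_linkT glue_gap_linkS hgl
          unglue_gap_link unglue_glue_gap).
Qed.

Lemma insert_is_glued :
  @is_glued T S tt R insert_disc insert_strand insert_region.
Proof.
have [strandE strand_surj strand_ker] := strand_hyps.
have [regionE region_surj region_ker] := region_hyps.
split=> //.
- by case=> [[]|] [[]|].
- case=> [[[]|]|[[]|]]; split.
  + by case=> -[[]|].
  + by case=> /(_ erefl).
  + by [].
  + by exists None.
  + by [].
  + by exists (Some tt).
  + by case=> -[[]|].
  + by case=> _ /(_ erefl).
- by case=> [[]|].
- case=> [[]|] a b ab.
    rewrite [sum_pt _](_ : _ = clsP (inr (Pt colS (Some tt) b))) // strandE.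
    by congr to_class; congr existT; exact: val_inj.
  rewrite [sum_pt _](_ : _ = clsP (inl (Pt colT None b))) // strandE.
  by congr to_class; congr existT; exact: val_inj.
- case=> [[]|] a b ab.
    rewrite [sum_itv _](_ : _ = clsG (inr (Gap colS (Some tt) b))) // regionE.
    by congr to_class; congr existT; exact: val_inj.
  rewrite [sum_itv _](_ : _ = clsG (inl (Gap colT None b))) // regionE.
  by congr to_class; congr existT; exact: val_inj.
- case=> X b; have [e <-] := to_class_surj X.
    have [g eg gb] := touch_ex shT e b.
    rewrite [sum_side _ _](congr1 inl (arc_sideE mTK shT eg gb)).
    rewrite (regionE (inl g)) (strandE (inl e)).
    have [g' eg' gg'] := glue_touchT eg.
    rewrite [LHS](arc_sideE mRK shR eg').
      by apply/(to_classP linkR_sym); rewrite linkR_sym.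
    by rewrite -(connect_shade shR gg') glue_gapT_shade.
  have [g eg gb] := touch_ex shS e b.
  rewrite [sum_side _ _](congr1 inr (arc_sideE mSK shS eg gb)).
  rewrite (regionE (inr g)) (strandE (inr e)).
  have [g' eg' gg'] := glue_touchS eg.
  rewrite [LHS](arc_sideE mRK shR eg').
    by apply/(to_classP linkR_sym); rewrite linkR_sym.
  by rewrite -(connect_shade shR gg') glue_gapS_shade.
- case=> X; have [g <-] := to_class_surj X.
    rewrite (regionE (inl g)) [LHS](arc_region_shade mR shR) /sum_shade.
    by rewrite [RHS](arc_region_shade mT shT) glue_gapT_shade.
  rewrite (regionE (inr g)) [LHS](arc_region_shade mR shR) /sum_shade.
  by rewrite [RHS](arc_region_shade mS shS) glue_gapS_shade.
Qed.

End InsertGlue.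

(** * Composites and the identity acting on a planar algebra *)

Section Action.
Variables (F : fieldType) (A : planar_algebra F) (k : nat).

Lemma tl_act_insert (i l : nat) (p : 'I_i.*2.+1) (D : tl_diagram i l) (x : box A k i.+1) :
  epi D -> tl_act (insert_cap p D) x = tl_act D (tl_act (insert_cap p (tl_id i)) x).
Proof.
move=> eD.
have plT := tl_planar k eD.
have plS : planar (tl_tangle k (insert_cap p (tl_id i))).
  by apply: tl_planar; rewrite insert_cap_epi tl_id_epi.
apply: (@eq_from_Tagged _ (Defs.space A)).
apply: (act_glue (p := A) plT plS (insert_is_glued k p D)) => //.
Qed.

(** The colours of the tangle of [tl_id] are constant only up to extensionality, so [act_id] does
    not apply directly. Abstracting over [col] and its equation allows the dependent types to be
    rewritten at once. *)
Lemma act_id_col (col : option unit -> color) (c : color) (colE : col = fun=> c)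
    (m : {v & points (col v)} -> {v & points (col v)})
    (x : forall d, Defs.space A (col (Some d))) :
    (forall v q, exists q', m (existT (fun v => points (col v)) v q)
        = existT (fun v => points (col v)) (if v is Some _ then None else Some tt) q'
        /\ q = q' :> nat) ->
  Tagged (Defs.space A) (@Defs.act _ A (arc_tangle m) x) = Tagged (Defs.space A) (x tt).
Proof.
subst col => mE.
have -> : m = fun e => existT (fun _ => points c)
    (if tag e is Some _ then None else Some tt) (tagged e).
  apply: functional_extensionality_dep => -[v q].
  by have [q' [-> qq']] := mE v q; congr existT; apply: val_inj.
have -> : x = fun=> x tt by apply: functional_extensionality_dep => -[].
by congr existT; exact: act_id.
Qed.

Lemma tl_act_id (i : nat) (x : box A k i) : tl_act (tl_id i) x = x.
Proof.
apply: (@eq_from_Tagged _ (Defs.space A)); apply: (act_id_col (c := ((i + k)%N, false))).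
  by apply: functional_extensionality_dep => -[[]|].
case=> [[]|] q; exists q; split=> //;
  rewrite -[q](box_splitK (i := i)); case: (box_split q) => [a|r].
- by apply: (etrans (tl_mate_top k (tl_id i) (inl a))); rewrite /= tl_id_funE.
- exact: (tl_mate_side (tl_id i) true r).
- by apply: (etrans (tl_mate_top k (tl_id i) (inr a))); rewrite /= tl_id_funE.
- exact: (tl_mate_side (tl_id i) false r).
Qed.

End Action.

(** * Inversion *)

Section Inversion.
Variables (F : fieldType) (A : planar_algebra F) (k : nat).
Local Open Scope ring_scope.
Local Notation box := (box A k).

Definition cap_act (i : nat) (p : 'I_i.*2.+1) : box i.+1 -> box i :=
  tl_act (insert_cap p (tl_id i)).

Definition X_from (q i l : nat) (x : box i) : box l :=
  \sum_(D : tl_diagram i l | epi D && caps_from q D) tl_act D x.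

Definition Y_upto (q i l : nat) (x : box i) : box l :=
  (-1) ^+ (i - l) *:
    \sum_(D : tl_diagram i l | [&& epi D, flat D & caps_upto q D]) tl_act D x.

Lemma X_blockN i l (x : box i) : X_block l (- x) = - X_block l x.
Proof. exact: (linearN (@X_block F A k i l : {linear box i -> box l})). Qed.

Lemma X_block_sum i l (I : Type) (r : seq I) (Q : pred I) (f : I -> box i) :
  X_block l (\sum_(a <- r | Q a) f a) = \sum_(a <- r | Q a) X_block l (f a).
Proof. exact: (linear_sum (@X_block F A k i l : {linear box i -> box l})). Qed.

Lemma X_fromE i l (x : box i) : X_block l x = X_from 0 l x.
Proof.
by apply: eq_bigl => D; rewrite (_ : caps_from 0 D) ?andbT //; apply/caps_fromP.
Qed.

Lemma Y_uptoE i l (x : box i) : Y_block l x = Y_upto i.*2 l x.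
Proof.
congr (_ *: _); apply: eq_bigl => D; rewrite non_nested_flat.
by rewrite (_ : caps_upto _ D) ?andbT //; apply/caps_uptoP => a b _ _; exact: ltn_ord.
Qed.

Lemma X_from0 q i l (x : box i) : (i < l)%N -> X_from q l x = 0.
Proof. by move=> il; apply: big1 => D /andP[/epi_leq]; rewrite leqNgt il. Qed.

Lemma Y_upto0 q i l (x : box i) : (i < l)%N -> Y_upto q l x = 0.
Proof.
move=> il; rewrite /Y_upto big1 ?scaler0 // => D /and3P[/epi_leq].
by rewrite leqNgt il.
Qed.

Lemma tl_id_no_cap i (a b : 'I_i.*2) : val (tl_id i) (inl a) <> inl b.
Proof. by rewrite /= tl_id_funE. Qed.

Lemma X_from_id q i (x : box i) : X_from q i x = x.
Proof.
rewrite /X_from (big_pred1 (tl_id i)) ?tl_act_id // => D; rewrite epi_id /=.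
case: eqP => //= ->; apply/caps_fromP => a b /tl_id_no_cap [].
Qed.

Lemma Y_upto_id q i (x : box i) : Y_upto q i x = x.
Proof.
rewrite /Y_upto (big_pred1 (tl_id i)) ?subnn ?expr0 ?scale1r ?tl_act_id // => D.
rewrite epi_id /=; case: eqP => //= ->; apply/andP; split.
  by apply/flatP => a b /tl_id_no_cap [].
by apply/caps_uptoP => a b /tl_id_no_cap [].
Qed.

Lemma X_from_rec q i l (x : box i.+1) : (l <= i)%N ->
  X_from q l x = \sum_(p : 'I_i.*2.+1 | (q <= p)%N) X_from p.-1 l (cap_act p x).
Proof.
move=> li; rewrite /X_from (sum_by_leftmost _ (li : (l < i.+1)%N)).
apply: eq_bigr => p _; apply: eq_bigr => D /andP[eD _].
exact: tl_act_insert.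
Qed.

Lemma Y_upto_rec q i l (x : box i.+1) : (l <= i)%N ->
  Y_upto q l x = - \sum_(p : 'I_i.*2.+1 | (p < q)%N) Y_upto p.-1 l (cap_act p x).
Proof.
move=> li; rewrite /Y_upto (sum_by_rightmost _ (li : (l < i.+1)%N)).
rewrite subSn // exprS mulN1r scaleNr -scaler_sumr; congr (- (_ *: _)).
apply: eq_bigr => p _; apply: eq_bigr => D /andP[eD _].
exact: tl_act_insert.
Qed.

(* Induction on i, by removing the rightmost cap of the diagrams in Y and the
   leftmost one of the diagrams in X_from. *)
Lemma sum_X_Y_upto q i l N (x : box i) : (i < N)%N ->
  \sum_(j < N) X_block l (Y_upto q j x) = X_from q l x.
Proof.
elim: i q x => [|i IH] q x iN.
  rewrite (bigD1 (Ordinal iN)) //= Y_upto_id big1 ?addr0 => [|j j0]; last first.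
    by rewrite Y_upto0 ?linear0 // lt0n.
  apply: eq_bigl => D; rewrite (_ : caps_from q D) ?andbT //.
  by apply/caps_fromP => -[].
have iN' := ltnW iN; pose j0 := Ordinal iN.
(* The term with [j = i.+1] gives [X] itself. In the others [Y_upto_rec] takes off a cap, after
   which the induction hypothesis applies for each [p]. *)
have -> : \sum_(j < N) X_block l (Y_upto q j x) = X_from 0 l x
    - \sum_(p : 'I_i.*2.+1 | (p < q)%N) X_from p.-1 l (cap_act p x).
  rewrite (bigD1 j0) //= Y_upto_id X_fromE; congr (_ + _).
  under [X in - X]eq_bigr => p _ do rewrite -(IH _ _ iN').
  rewrite exchange_big /= [X in - X](bigD1 j0) //= [X in - (X + _)]big1 ?add0r.
    rewrite -sumrN; apply: eq_bigr => j ji.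
    have [lt_ji|le_ij] := ltnP j i.+1.
      by rewrite Y_upto_rec // X_blockN X_block_sum.
    have lt_ij : (i.+1 < j)%N by rewrite ltn_neqAle eq_sym ji.
    rewrite Y_upto0 // linear0 big1 ?oppr0 // => p _.
    by rewrite Y_upto0 ?linear0 // ltnW.
  by move=> p _; rewrite Y_upto0 ?linear0.
have [li|il] := leqP l i.
  (* The expansion of [X_from 0] runs over all [p]; its terms with [p < q] cancel. *)
  rewrite !X_from_rec // (bigID (fun p : 'I_i.*2.+1 => (p < q)%N)) /= addrAC subrr add0r.
  by apply: eq_bigl => p; rewrite -leqNgt.
rewrite [X in _ - X]big1 ?subr0; last by move=> p _; rewrite X_from0.
case: (ltngtP l i.+1) => [|li|E]; first by rewrite ltnNge il.
  by rewrite !X_from0.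
by move: E => ->; rewrite !X_from_id.
Qed.

Lemma sum_X_Y l N (v : forall n, box n) : (forall n, (N <= n)%N -> v n = 0) ->
  \sum_(j < N) X_block l (\sum_(i < N) Y_block j (v i)) = v l.
Proof.
move=> vN; under eq_bigr => j _ do rewrite X_block_sum.
rewrite exchange_big /=.
have E (i : 'I_N) : \sum_(j < N) X_block l (Y_block j (v i)) = X_from i.*2 l (v i).
  by rewrite -(sum_X_Y_upto _ _ _ (ltn_ord i)); under eq_bigr => j _ do rewrite Y_uptoE.
under eq_bigr => i _ do rewrite E.
(* With the bound [i.*2], the innermost caps would have to start beyond the bottom points, so only
   the identity diagram survives. *)
have X0 (i : nat) : i != l -> X_from i.*2 l (v i) = 0.
  rewrite neq_ltn => /orP[il|li]; first exact: X_from0.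
  apply: big1 => D /andP[_].
  by case: i li D => // i li D; rewrite epi_no_caps_from.
have [lN|Nl] := ltnP l N.
  rewrite (bigD1 (Ordinal lN)) //= X_from_id big1 ?addr0 // => i il.
  by apply: X0.
rewrite vN // big1 // => i _; apply: X0.
by rewrite neq_ltn (leq_trans (ltn_ord i) Nl).
Qed.

Lemma XY_id (v : P_sum A k) : X A k (Y A k v) = v.
Proof.
apply: dsumP => l; have [N vN] := dcoord_fin v.
have YvN n : (N <= n)%N -> dcoord (Y A k v) n = 0.
  move=> Nn; rewrite [LHS](blocks_coordE _ n vN); apply: big1 => i _.
  by apply: Y_block_tri; exact: leq_trans (ltn_ord i) Nn.
rewrite [LHS](blocks_coordE _ l YvN).
under eq_bigr => j _ do rewrite [dcoord _ j](blocks_coordE _ j vN).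
exact: sum_X_Y.
Qed.

Lemma X_inj0 (v : P_sum A k) : X A k v = 0 -> v = 0.
Proof.
move=> Xv; have [N vN] := dcoord_fin v.
(* Descending induction on the coordinate, [t] counting the steps below [N]: coordinate [n] of [X v]
   is that of [v] plus contributions of higher coordinates. *)
suff v0 t n : (N <= n + t)%N -> dcoord v n = 0.
  by apply: dsumP => n; apply: (v0 N); rewrite leq_addl.
elim: t n => [|t IH] n; first by rewrite addn0; exact: vN.
move=> Nn; have [|nN] := leqP N n; first exact: vN.
have := congr1 (fun u : P_sum A k => dcoord u n) Xv.
rewrite /= (blocks_coordE _ n vN) (bigD1 (Ordinal nN)) //= X_fromE X_from_id.
rewrite big1 ?addr0 // => i ni.
have [lt_in|le_ni] := ltnP i n; first exact: X_block_tri.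
rewrite IH ?linear0 //; have : (n < i)%N by rewrite ltn_neqAle eq_sym le_ni andbT.
by move=> lt_ni; apply: leq_trans Nn _; rewrite addnS -addSn leq_add2r.
Qed.

Lemma YX_id (v : P_sum A k) : Y A k (X A k v) = v.
Proof.
by apply/eqP; rewrite -subr_eq0; apply/eqP/X_inj0; rewrite linearB /= XY_id subrr.
Qed.

End Inversion.

Theorem lemma5p1 (R : realType) (P : subfactor_planar_algebra R) (k : nat) :
  (forall v : P_sum P k, X P k (Y P k v) = v) /\
  (forall v : P_sum P k, Y P k (X P k v) = v).
Proof. by split; [exact: XY_id|exact: YX_id]. Qed.
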